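(* Let $\lambda$ be a partition of $2n$ in which each odd part occurs with even multiplicity, and let $m_j$ be the multiplicity of $j$ in $\lambda$. Let $\overline{\mathcal{Q}}=(\mathcal{Q}_2,\mathcal{Q}_4,\ldots,\mathcal{Q}_{2n})$ be an $n$-tuple of (isometry classes of) nondegenerate quadratic forms over $k$ with $\dim\mathcal{Q}_j=m_j$, and choose a minimal matrix representative $Q_j$ of each nonzero $\mathcal{Q}_j$. Let $X$ be the endomorphism of $V=\bigoplus_{j:m_j\ne0}V(j)$, where, with $s_i=\sum_{j<i}\frac12jm_j$, $$V(j)=\mathrm{span}\{p_{s_j+1},\ldots,p_{s_j+\frac12jm_j},q_{s_j+1},\ldots,q_{s_j+\frac12jm_j}\},$$ preserving each $V(j)$ and given with respect to this ordered basis of $V(j)$ as follows. If $j$ is odd, $$X|_{V(j)}=\begin{pmatrix}J_\mu&0\\0&-J_\mu^\dagger\end{pmatrix},$$ where $\mu$ is the partition of $\frac12jm_j$ consisting of $\frac12m_j$ copies of $j$. If $j=2N$ is even, $$X|_{V(j)}=\begin{pmatrix}(J_{Nm_j})^{m_j}&Z\oplus(-1)^NQ_j\\0&-\big((J_{Nm_j})^{m_j}\big)^\dagger\end{pmatrix},$$ where $Z$ is the $m_j(N-1)\times m_j(N-1)$ zero matrix and $(J_{Nm_j})^{m_j}=J_N\otimes I_{m_j}$ is the $m_j$-th power of the single Jordan block $J_{Nm_j}$. Then the matrix $X\in\mathfrak{g}$ is a representative of the $G$-orbit in $\mathcal{O}_\lambda(k)$ corresponding to the $n$-tuple of quadratic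 forms $\overline{\mathcal{Q}}$.
   Context: Setting. $k$ is a non-Archimedean local field with algebraic closure $K$, uniformizer $\varpi$ and valuation $\mathrm{val}$, of odd residual characteristic, and of characteristic $0$ or of characteristic $p>3(2n-1)$; $n\ge2$. $V=k^{2n}$ has symplectic form $\langle x,y\rangle=x^\dagger Jy$, $J=\begin{pmatrix}0&I\\-I&0\end{pmatrix}$ ($\dagger$ = transpose), $G=\mathrm{Sp}_{2n}(k)$, $\mathfrak{g}=\mathfrak{sp}_{2n}(k)$. $\{p_1,\ldots,p_n,q_1,\ldots,q_n\}$ is an ordered symplectic basis of $V$: $\langle p_i,q_j\rangle=\delta_{ij}=-\langle q_j,p_i\rangle$, all other pairings zero. $\mathcal{O}_\lambda$ is the $\mathrm{Sp}_{2n}(K)$-orbit of nilpotent elements of $\mathfrak{sp}_{2n}(K)$ with Jordan block sizes the parts of $\lambda$, and $\mathcal{O}_\lambda(k)=\mathcal{O}_\lambda\cap\mathfrak{g}$. $J_\mu$ is the upper triangular nilpotent Jordan matrix with blocks of sizes the parts of $\mu$; $J_N$ is a single $N\times N$ Jordan block; $I_m$ is the identity matrix. Correspondence. $G$-orbits in $\mathcal{O}_\lambda(k)$ are parametrized by such tuples $\overline{\mathcal{Q}}$: given $X\in\mathcal{O}_\lambda(k)$, take a Lie triple $(Y,H,X)$ in $\mathfrak{g}$ ($[H,X]=2X$, $[H,Y]=-2Y$, $[X,Y]=H$); for $j$ even let $L(j)$ be the lowest weight space (killed by $Y$, $H$-eigenvalue $1-j$) of the isotypic component of $V$ of $j$-dimensional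 irreducible $\mathfrak{sl}_2$-submodules; then $\mathcal{Q}_j$ is the isometry class of the nondegenerate symmetric form $(v,w)_j=\langle v,X^{j-1}w\rangle$ on $L(j)$ (with $\mathcal{Q}_j=0$ if $m_j=0$). Minimal matrix representatives. Let $\varepsilon\in k^\times$ be a non-square with $\mathrm{val}(\varepsilon)=0$; if $-1\in(k^\times)^2$ set $\alpha=\varepsilon$, and otherwise take $\varepsilon=-1$ and $\alpha=1$. Let $q_0=\begin{pmatrix}0&1\\1&0\end{pmatrix}$ (hyperbolic plane). A minimal matrix representative of a nondegenerate quadratic form $\mathcal{Q}$ is a matrix representing it of the form $q_0^m\oplus Q_{\mathrm{aniso}}$ ($m\ge0$ copies of $q_0$), where $Q_{\mathrm{aniso}}$ is empty or one of the following 15 diagonal matrices, which represent the anisotropic forms: dimension 1: $1,\varepsilon,\varpi,\varepsilon\varpi$; dimension 2: $\mathrm{diag}(1,\alpha)$, $\mathrm{diag}(\varpi,\alpha\varpi)$, $\mathrm{diag}(t,t'\varpi)$ with $t,t'\in\{1,\varepsilon\}$; dimension 3: $\mathrm{diag}(\alpha t,\varpi,\alpha\varpi)$ and $\mathrm{diag}(1,\alpha,t\varpi)$ with $t\in\{1,\varepsilon\}$; dimension 4: $\mathrm{diag}(1,-\varepsilon,-\varpi,\varepsilon\varpi)$. *)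

(* Defs.v *)
From HB Require Import structures.
From mathcomp Require Import all_boot all_order all_algebra.

Set Implicit Arguments.
Unset Strict Implicit.
Unset Printing Implicit Defensive.

Import Order.TTheory GRing.Theory Num.Theory.
Local Open Scope ring_scope.

(** ** Non-Archimedean local fields *)

(* The value [val 0] is irrelevant; [val_ge val x M] is "val x >= M" with the
   convention val 0 = +oo. *)
Definition val_ge (k : fieldType) (val : k -> int) (x : k) (M : int) : Prop :=
  x = 0 \/ M <= val x.

Definition val_cauchy (k : fieldType) (val : k -> int) (u : nat -> k) : Prop :=
  forall M : int, exists N : nat, forall i j : nat,
    (N <= i)%N -> (N <= j)%N -> val_ge val (u i - u j) M.

Definition val_cvg (k : fieldType) (val : k -> int) (u : nat -> k) (l : k)
    : Prop :=
  forall M : int, exists N : nat, forall i : nat,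
    (N <= i)%N -> val_ge val (u i - l) M.

(* A field complete for a normalized discrete valuation with finite residue
   field; finiteness is stated by a finite list of integers of [k] that meets
   every coset of the maximal ideal. *)
Record is_local_field (k : fieldType) (val : k -> int) : Prop := IsLocalField {
  valM : forall x y : k, x != 0 -> y != 0 -> val (x * y) = val x + val y;
  valD : forall x y : k, x != 0 -> y != 0 -> x + y != 0 ->
           Num.min (val x) (val y) <= val (x + y);
  val_normalized : exists2 x : k, x != 0 & val x = 1;
  val_complete : forall u : nat -> k, val_cauchy val u ->
                   exists l : k, val_cvg val u l;
  finite_residue_field : exists s : seq k,
    (forall r : k, r \in s -> val_ge val r 0) /\
    (forall x : k, val_ge val x 0 -> exists2 r, r \in s & val_ge val (x - r) 1)
}.

Definition is_uniformizer (k : fieldType) (val : k -> int) (w : k) : Prop :=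
  w != 0 /\ val w = 1.

(* [p] is the characteristic of the residue field: p.1 lies in the maximal
   ideal. *)
Definition residue_char (k : fieldType) (val : k -> int) (p : nat) : Prop :=
  prime p /\ val_ge val (p%:R : k) 1.

Definition is_square (k : fieldType) (x : k) : Prop := exists y : k, x = y ^+ 2.

(** ** Partitions and Jordan matrices *)

Definition is_partition (N : nat) (la : seq nat) : Prop :=
  [/\ sorted geq la, all (leq 1) la & sumn la = N].

Definition mult (la : seq nat) (j : nat) : nat := count_mem j la.

Definition jordan_block (R : pzRingType) (N : nat) : 'M[R]_N :=
  \matrix_(a < N, b < N) (b == a.+1 :> nat)%:R.

Definition jordan_mx (R : pzRingType) (mu : seq nat)
    : 'M[R]_(\sum_(i < size mu) nth 0%N mu i) :=
  \mxdiag_(i < size mu) jordan_block R (nth 0%N mu i).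

(** ** The symplectic group, its Lie algebra, nilpotent orbits *)

Section Symplectic.
Variables (R : fieldType) (n : nat).
Implicit Types (A g X Y H : 'M[R]_(n + n)) (x y v : 'cV[R]_(n + n)).

Definition Jmx : 'M[R]_(n + n) := block_mx 0 1%:M (- 1%:M) 0.

Definition sform x y : R := (x^T *m Jmx *m y) 0 0.

Definition Sp g : Prop := g^T *m Jmx *m g = Jmx.

Definition sp A : Prop := A^T *m Jmx + Jmx *m A = 0.

Definition symplectic_basis (p q : 'I_n -> 'cV[R]_(n + n)) : Prop :=
  [/\ forall i j, sform (p i) (q j) = (i == j)%:R,
      forall i j, sform (q j) (p i) = - (i == j)%:R,
      forall i j, sform (p i) (p j) = 0 &
      forall i j, sform (q i) (q j) = 0].

Definition has_jordan_type (la : seq nat) A : Prop :=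
  exists e : (\sum_(i < size la) nth 0%N la i)%N = (n + n)%N,
  exists2 P : 'M[R]_(n + n), P \in unitmx &
    P *m A *m invmx P = castmx (e, e) (jordan_mx R la).

Definition nilpotent_mx A : Prop := exists N : nat, A ^+ N = 0.

Definition nil_orbit (la : seq nat) A : Prop :=
  [/\ sp A, nilpotent_mx A & has_jordan_type la A].

Definition Sp_orbit X (X' : 'M[R]_(n + n)) : Prop :=
  exists2 g, Sp g & X' = g *m X *m invmx g.

(** ** Lie triples and the attached quadratic forms *)

Definition bracket A (B : 'M[R]_(n + n)) : 'M[R]_(n + n) := A *m B - B *m A.

Definition lie_triple Y H X : Prop :=
  [/\ sp Y, sp H & sp X] /\
  [/\ bracket H X = X *+ 2, bracket H Y = - (Y *+ 2) & bracket X Y = H].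

Definition sl2_submodule Y H X (U : {vspace 'cV[R]_(n + n)}) : Prop :=
  forall v, v \in U -> [/\ Y *m v \in U, H *m v \in U & X *m v \in U].

Definition sl2_irreducible Y H X (U : {vspace 'cV[R]_(n + n)}) : Prop :=
  [/\ sl2_submodule Y H X U, U != 0%VS &
      forall W : {vspace 'cV[R]_(n + n)},
        sl2_submodule Y H X W -> (W <= U)%VS -> W = 0%VS \/ W = U].

Definition in_isotypic Y H X (j : nat) v : Prop :=
  exists (r : nat) (U : 'I_r -> {vspace 'cV[R]_(n + n)}),
    (forall i, sl2_irreducible Y H X (U i) /\ \dim (U i) = j) /\
    v \in (\sum_(i < r) U i)%VS.

Definition in_lowest Y H X (j : nat) v : Prop :=
  [/\ in_isotypic Y H X j v, Y *m v = 0 & H *m v = (1 - j%:R) *: v].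

(* The form (v, w)_j on L(j) is isometric to the form with matrix [q]: the
   columns of [B] are a basis of L(j) with Gram matrix [q]. *)
Definition lowest_form_isometric Y H X (j m : nat) (q : 'M[R]_m) : Prop :=
  exists B : 'M[R]_(n + n, m),
    [/\ \rank B = m,
        forall v, in_lowest Y H X j v <-> (exists c : 'cV[R]_m, v = B *m c) &
        forall a b : 'I_m,
          sform (col a B) (X ^+ j.-1 *m col b B) = q a b].

(* Only the entries [q j] with [j] even and 2 <= j <= 2n are meaningful. *)
Definition attached_forms (la : seq nat) X
    (q : forall j : nat, 'M[R]_(mult la j)) : Prop :=
  (exists Y H, lie_triple Y H X) /\
  (forall Y H, lie_triple Y H X ->
     forall j : nat, ~~ odd j -> (2 <= j <= n.*2)%N ->
       lowest_form_isometric Y H X j (q j)).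

End Symplectic.

(* O_la(k), for an embedding [iota] of k in its algebraic closure K. *)
Definition rational_nil_orbit (k K : fieldType) (iota : {rmorphism k -> K})
    (n : nat) (la : seq nat) (A : 'M[k]_(n + n)) : Prop :=
  sp A /\ nil_orbit la (map_mx iota A).

(* [O] is a G-orbit in O_la(k) whose attached tuple is [q]. *)
Definition orbit_corresponds (k K : fieldType) (iota : {rmorphism k -> K})
    (n : nat) (la : seq nat) (q : forall j : nat, 'M[k]_(mult la j))
    (O : 'M[k]_(n + n) -> Prop) : Prop :=
  (exists X0, forall X, O X <-> Sp_orbit X0 X) /\
  (forall X, O X -> rational_nil_orbit iota la X /\ attached_forms X q).

(** ** Quadratic forms and minimal matrix representatives *)

(* In odd residual characteristic 2 is invertible, so a nondegenerate quadratic
   form is identified with its invertible symmetric Gram matrix. *)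
Definition nondeg_form (k : fieldType) (m : nat) (q : 'M[k]_m) : Prop :=
  q^T = q /\ q \in unitmx.

Definition isometric (k : fieldType) (m : nat) (q q' : 'M[k]_m) : Prop :=
  exists2 g : 'M[k]_m, g \in unitmx & g^T *m q *m g = q'.

Definition q0 (k : fieldType) : 'M[k]_2 :=
  \matrix_(a < 2, b < 2) (a != b)%:R.

Definition aniso_diags (k : fieldType) (eps alpha w : k) : seq (seq k) :=
  [:: [:: 1]; [:: eps]; [:: w]; [:: eps * w];
      [:: 1; alpha]; [:: w; alpha * w];
      [:: 1; w]; [:: 1; eps * w]; [:: eps; w]; [:: eps; eps * w];
      [:: alpha; w; alpha * w]; [:: alpha * eps; w; alpha * w];
      [:: 1; alpha; w]; [:: 1; alpha; eps * w];
      [:: 1; - eps; - w; eps * w]].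

Definition is_minimal_matrix (k : fieldType) (eps alpha w : k) (m : nat)
    (Q : 'M[k]_m) : Prop :=
  exists (h : nat) (d : seq k) (e : (\sum_(i < h) 2 + size d)%N = m),
    (d = [::] \/ d \in aniso_diags eps alpha w) /\
    Q = castmx (e, e)
          (block_mx (\mxdiag_(i < h) q0 k) 0 0
                    (diag_mx (\row_(i < size d) nth 0 d i))).

Definition minimal_representative (k : fieldType) (eps alpha w : k) (m : nat)
    (q Q : 'M[k]_m) : Prop :=
  is_minimal_matrix eps alpha w Q /\ isometric q Q.

(** ** The normal form *)

Section NormalForm.
Variables (k : fieldType) (n : nat) (la : seq nat).
Variable Q : forall j : nat, 'M[k]_(mult la j).

(* dim V(j) = 2 (half_dim j). *)
Definition half_dim (j : nat) : nat := (j * mult la j)./2.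

Definition shift (j : nat) : nat := (\sum_(1 <= i < j) half_dim i)%N.

(* The two uses of [conform_mx 0] below are casts: for la with even
   multiplicities of odd parts, and 0 < j, the sizes agree (lemmas
   [odd_block_size] and [even_block_size]). *)
Definition odd_block (j : nat) : 'M[k]_(half_dim j + half_dim j) :=
  let A : 'M[k]_(half_dim j) :=
    conform_mx 0 (jordan_mx k (nseq (mult la j)./2 j)) in
  block_mx A 0 0 (- A^T).

Definition even_block (j : nat) : 'M[k]_(half_dim j + half_dim j) :=
  let N := j./2 in
  let A : 'M[k]_(half_dim j) := jordan_block k (half_dim j) ^+ mult la j in
  let C : 'M[k]_(half_dim j) :=
    conform_mx 0 (block_mx (0 : 'M[k]_(mult la j * N.-1)) 0
                           0 ((-1) ^+ N *: Q j)) in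
  block_mx A C 0 (- A^T).

Definition Xblock (j : nat) : 'M[k]_(half_dim j + half_dim j) :=
  if odd j then odd_block j else even_block j.

(* Inclusion, in the coordinates given by p_1, ..., p_n, q_1, ..., q_n, of
   V(j) in V. *)
Definition incl (j : nat) : 'M[k]_(n + n, half_dim j + half_dim j) :=
  let I : 'M[k]_(n, half_dim j) :=
    \matrix_(i < n, a < half_dim j) (i == shift j + a :> nat)%:R in
  block_mx I 0 0 I.

Variables p q : 'I_n -> 'cV[k]_(n + n).

Definition basis_mx : 'M[k]_(n + n) :=
  row_mx (\matrix_(u, i) p i u 0) (\matrix_(u, i) q i u 0).

(* The columns are the ordered basis of V(j). *)
Definition Vbasis (j : nat) : 'M[k]_(n + n, half_dim j + half_dim j) :=
  basis_mx *m incl j.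

(* The matrix, in the standard basis of V = k^2n, of the direct sum of the
   [Xblock j]; see [normal_form_Vbasis]. *)
Definition normal_form : 'M[k]_(n + n) :=
  basis_mx
  *m (\sum_(1 <= j < n.*2.+1 | mult la j != 0%N)
        incl j *m Xblock j *m (incl j)^T)
  *m invmx basis_mx.

End NormalForm.

Lemma basis_mx_unit (k : fieldType) (n : nat) (p q : 'I_n -> 'cV[k]_(n + n)) :
  symplectic_basis p q -> basis_mx p q \in unitmx.
Proof.
move=> [hpq hqp hpp hqq].
have gram (f g : 'I_n -> 'cV[k]_(n + n)) :
    (\matrix_(u, i) f i u 0)^T *m Jmx k n *m (\matrix_(u, i) g i u 0)
    = \matrix_(i, j) sform (f i) (g j).
  apply/matrixP => i j; rewrite [RHS]mxE /sform [LHS]mxE [RHS]mxE.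
  apply: eq_bigr => v _; rewrite [X in _ * X = _]mxE; congr (_ * _).
  rewrite [LHS]mxE [RHS]mxE; apply: eq_bigr => u _; congr (_ * _).
  by rewrite [LHS]mxE [RHS]mxE mxE.
have gramJ : (basis_mx p q)^T *m Jmx k n *m basis_mx p q = Jmx k n.
  rewrite /basis_mx tr_row_mx mul_col_mx mul_col_row !gram /Jmx.
  congr block_mx; apply/matrixP => i j; rewrite !mxE ?hpp ?hqq ?hpq ?hqp //.
  by rewrite eq_sym.
have JJ : (- Jmx k n) *m Jmx k n = 1%:M.
  rewrite /Jmx mulNmx mulmx_block !mul0mx !mulmx0 !add0r !addr0 mul1mx mulmx1.
  by rewrite opp_block_mx !opprK !oppr0 -scalar_mx_block.
have /mulmx1_unit[_ //] :
    (- Jmx k n *m (basis_mx p q)^T *m Jmx k n) *m basis_mx p q = 1%:M.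
by rewrite -!mulmxA [_^T *m _]mulmxA gramJ.
Qed.

Section NormalFormFacts.
Variables (k : fieldType) (n : nat) (la : seq nat).
Hypothesis la_part : is_partition n.*2 la.
Hypothesis la_odd : forall j, odd j -> ~~ odd (mult la j).

Lemma odd_block_size (j : nat) : odd j ->
  (\sum_(i < size (nseq (mult la j)./2 j)) nth 0 (nseq (mult la j)./2 j) i)%N
  = half_dim la j.
Proof.
move=> jo; set s := nseq _ _.
rewrite -(big_mkord xpredT (nth 0%N s)) -(big_nth 0%N xpredT id) big_nseq.
rewrite iter_addn_0 /half_dim -{2}(odd_double_half (mult la j)).
by rewrite (negbTE (la_odd jo)) add0n -doubleMr doubleK mulnC.
Qed.

Lemma even_block_size (j : nat) : ~~ odd j -> (0 < j)%N ->
  (mult la j * (j./2).-1 + mult la j)%N = half_dim la j.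
Proof.
move=> je j_gt0; rewrite addnC -mulnS prednK; last first.
  by move: j_gt0; rewrite -{1}(odd_double_half j) (negbTE je) double_gt0.
rewrite /half_dim; move: (mult la j) => m.
rewrite -[X in _ = (X * m)./2]odd_double_half (negbTE je) add0n.
by rewrite -doubleMl doubleK mulnC.
Qed.

Lemma half_dimE (j : nat) : (half_dim la j).*2 = (j * mult la j)%N.
Proof.
rewrite -[RHS]odd_double_half oddM; case: (boolP (odd j)) => //= jo.
by rewrite (negbTE (la_odd jo)).
Qed.

Lemma shift_total : shift la n.*2.+1 = n.
Proof.
case: la_part => _ /allP la_gt0 la_sum; apply: double_inj.
have la_le (x : nat) : x \in la -> (x < n.*2.+1)%N.
  rewrite ltnS -la_sum => /(@perm_to_rem _ x la) /perm_sumn ->.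
  by rewrite /= leq_addr.
rewrite -[RHS]la_sum /shift -muln2 big_distrl /=.
under eq_bigr => i _ do rewrite muln2 half_dimE.
move: (n.*2.+1) la_le la_gt0 => N; move: {la_sum} la.
elim=> [|x s IHs] bnd pos /=.
  by apply: big1 => i _; rewrite /mult /= muln0.
rewrite -IHs; first last.
- by move=> y ys; apply: pos; rewrite inE ys orbT.
- by move=> y ys; apply: bnd; rewrite inE ys orbT.
under eq_bigr => i _ do rewrite /mult /= mulnDr.
rewrite big_split /=; congr (_ + _)%N.
rewrite (bigD1_seq x) ?iota_uniq //=; last first.
  by rewrite mem_index_iota (pos x) ?(bnd x) ?mem_head.
rewrite eqxx muln1 big1 ?addn0 // => i /negbTE nix.
by rewrite eq_sym nix muln0.
Qed.

Lemma shiftS (j : nat) : (0 < j)%N ->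
  shift la j.+1 = (shift la j + half_dim la j)%N.
Proof. by move=> j_gt0; rewrite /shift big_nat_recr. Qed.

Lemma leq_shift (i j : nat) : (0 < i)%N -> (i <= j)%N ->
  (shift la i <= shift la j)%N.
Proof. by move=> i0 ij; rewrite /shift [leqRHS](@big_cat_nat _ _ _ i) //=; exact: leq_addr. Qed.

Lemma incl_mul_id (j : nat) : (0 < j <= n.*2)%N ->
  (incl k n la j)^T *m incl k n la j = 1%:M.
Proof.
move=> /andP[j_gt0 j_le]; rewrite /incl tr_block_mx mulmx_block.
rewrite !trmx0 !mul0mx !mulmx0 !add0r !addr0 scalar_mx_block.
suff -> : (\matrix_(i < n, a < half_dim la j)
             (i == shift la j + a :> nat)%:R : 'M[k]__)^T
       *m \matrix_(i < n, a < half_dim la j) (i == shift la j + a :> nat)%:R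
       = 1%:M by [].
apply/matrixP => a b; rewrite !mxE.
have lt_n : (shift la j + a < n)%N.
  rewrite -[X in (_ < X)%N]shift_total.
  apply: leq_trans (leq_shift _ (_ : j.+1 <= _)%N) => //.
  by rewrite shiftS // ltn_add2l.
rewrite (bigD1 (Ordinal lt_n)) //= !mxE eqxx mul1r eqn_add2l.
rewrite big1 ?addr0 // => i; rewrite !mxE -val_eqE /= => /negbTE ->.
by rewrite mul0r.
Qed.

Lemma incl_mul_neq (i j : nat) : (0 < i)%N -> (0 < j)%N -> i != j ->
  (incl k n la i)^T *m incl k n la j = 0.
Proof.
move=> i0 j0 ij; rewrite /incl tr_block_mx mulmx_block.
rewrite !trmx0 !mul0mx !mulmx0 !add0r !addr0.
suff -> : (\matrix_(u < n, a < half_dim la i)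
             (u == shift la i + a :> nat)%:R : 'M[k]__)^T
       *m \matrix_(u < n, a < half_dim la j) (u == shift la j + a :> nat)%:R
       = 0 by rewrite block_mx0.
apply/matrixP => a b; rewrite !mxE big1 // => u _; rewrite !mxE.
have [eu|] := eqVneq (u : nat) (shift la i + a)%N; rewrite ?mul0r // mul1r.
have [ev|//] := eqVneq (u : nat) (shift la j + b)%N.
case: ltngtP ij => // lt_ij _.
- have := leq_shift (isT : 0 < i.+1)%N lt_ij; rewrite shiftS //.
  have lta := ltn_ord a; move=> le1; exfalso.
  have : (shift la i + a < shift la j + b)%N.
    apply: leq_trans (leq_trans le1 (leq_addr b _)).
    by rewrite ltn_add2l.
  by rewrite -eu -ev ltnn.
- have := leq_shift (isT : 0 < j.+1)%N lt_ij; rewrite shiftS //.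
  have ltb := ltn_ord b; move=> le1; exfalso.
  have : (shift la j + b < shift la i + a)%N.
    apply: leq_trans (leq_trans le1 (leq_addr a _)).
    by rewrite ltn_add2l.
  by rewrite -eu -ev ltnn.
Qed.

Lemma normal_form_Vbasis (Q : forall j, 'M[k]_(mult la j))
    (p q : 'I_n -> 'cV[k]_(n + n)) (j : nat) :
  symplectic_basis p q -> (0 < j <= n.*2)%N -> mult la j != 0%N ->
  normal_form Q p q *m Vbasis la p q j = Vbasis la p q j *m Xblock Q j.
Proof.
move=> pq j_bnd mj; have /andP[j0 jn] := j_bnd.
rewrite /normal_form /Vbasis -!mulmxA (mulKmx (basis_mx_unit pq)).
congr (_ *m _); rewrite mulmx_suml.
rewrite big_mkcond (bigD1_seq j) ?iota_uniq ?mem_index_iota ?j0 //= mj.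
rewrite big1_seq => [|i /andP[ij]]; last first.
  rewrite mem_index_iota => /andP[i0 _]; case: ifP => // _.
  by rewrite -!mulmxA incl_mul_neq // !mulmx0.
by rewrite addr0 -!mulmxA incl_mul_id // mulmx1.
Qed.

End NormalFormFacts.

(* Main.v *)
Require Import Defs.

From mathcomp Require Import all_boot all_order all_algebra ring zify.
Import Order.TTheory GRing.Theory Num.Theory.
Local Open Scope ring_scope.

Set Implicit Arguments.
Unset Strict Implicit.
Unset Printing Implicit Defensive.

(** Why the theorem is true.  The orbit is that of X itself, so two things have
    to be seen: that X has the right Jordan type, and that for every Lie triple
    through any symplectic conjugate of X the forms on the lowest weight spaces
    L(j) are the prescribed ones.

    The form attached to j is intrinsic to X.  It lives on the quotient of
    ker X^j by ker X^(j-1) + (ker X^j meet im X), where v, w |-> <v, X^(j-1) w>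
    is well defined because X is skew for the symplectic form.  Whatever the
    triple (Y, H, X), the space L(j) maps isomorphically onto this quotient:
    the map is onto by [exists_lowest] and one-to-one by [lowest_im_eq0].  Both
    come from the identity expressing that H acts as the scalar i on
    ker X meet im X^i modulo im X^(i+1) ([ker_im_step]), the integers up
    to 4n being invertible in k.  So the form can be read off on any complement
    of ker X^(j-1) + (ker X^j meet im X) in ker X^j.

    Such complements are provided by Jordan generators: matrices W_j whose
    columns generate the Jordan chains of length j.  They give the Jordan type
    ([generators_jordan_type]), they span the quotient above
    ([ker_exp_generators]), and if their Gram matrix W_j^T J X^(j-1) W_j is Q_j
    then the form on L(j) is isometric to Q_j for every triple
    ([lowest_form_generators]).  These data are transported by symplectic
    conjugation, hence exist on the whole orbit as soon as they exist for the
    matrix of X in a symplectic basis.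

    There everything is explicit.  On V(j) with j = 2N, group the basis into
    p-blocks F_0, ..., F_(N-1) and q-blocks of m_j vectors each.  Then X sends
    the q-block t to minus the q-block t+1, the last q-block to (-1)^N Q_j
    times the last p-block, and the p-block t to the p-block t-1.  The first
    q-block W_j therefore generates everything, X^(2N-1) W_j is minus
    the p-block F_0 times Q_j, and pairing with W_j gives Q_j because
    <q, p> = -1.  For j odd X preserves the span of the p's and that of the q's,
    and the generators are the last p-block together with the first q-block.
    A Lie triple through X is written down on the same blocks
    ([frame_lie_triple]): H scales the p-block t by j - 1 - 2t, and Y raises t
    with the coefficient (t+1)(j-t-1) familiar from irreducible
    sl_2-modules. *)

(** * Representations of sl_2 generated by lowest weight vectors *)

(** Throughout, an n x r matrix stands for a family of r column vectors, so that
    a statement about vectors holds at once for a whole basis. *)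
Section MatrixPowers.
Variables (R : pzRingType) (N r : nat).
Implicit Types (X : 'M[R]_N) (v : 'M[R]_(N, r)).

Lemma exp0mx X v : X ^+ 0 *m v = v.
Proof. by rewrite expr0 mul1mx. Qed.

Lemma expSmx X i v : X ^+ i.+1 *m v = X *m (X ^+ i *m v).
Proof. by rewrite exprS -mulmxE mulmxA. Qed.

Lemma expDmx X i j v : X ^+ (i + j) *m v = X ^+ i *m (X ^+ j *m v).
Proof. by rewrite exprD -mulmxE mulmxA. Qed.

Lemma expSrmx X i v : X ^+ i.+1 *m v = X ^+ i *m (X *m v).
Proof. by rewrite -addn1 expDmx expr1. Qed.

End MatrixPowers.

Definition sl2_relations (k : pzRingType) (N : nat) (X Y H : 'M[k]_N) : Prop :=
  [/\ H *m X - X *m H = X *+ 2, H *m Y - Y *m H = - (Y *+ 2)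
    & X *m Y - Y *m X = H].

Section Sl2.
Variables (k : fieldType) (N : nat) (X Y H : 'M[k]_N).
Hypothesis sl2 : sl2_relations X Y H.

Let HX r (v : 'M[k]_(N, r)) : H *m (X *m v) = X *m (H *m v) + (X *m v) *+ 2.
Proof.
case: sl2 => h _ _; rewrite !mulmxA -[H *m X](subrK (X *m H)) h.
by rewrite mulmxDl addrC mulmxDl.
Qed.

Let HY r (v : 'M[k]_(N, r)) : H *m (Y *m v) = Y *m (H *m v) - (Y *m v) *+ 2.
Proof.
case: sl2 => _ h _; rewrite !mulmxA -[H *m Y](subrK (Y *m H)) h.
by rewrite mulmxDl addrC mulNmx mulmxDl.
Qed.

Let XY r (v : 'M[k]_(N, r)) : X *m (Y *m v) = Y *m (X *m v) + H *m v.
Proof.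
case: sl2 => _ _ h; rewrite !mulmxA -[X *m Y](subrK (Y *m X)) h.
by rewrite mulmxDl addrC.
Qed.

Section Vectors.
Variable r : nat.
Implicit Types (u v h y : 'M[k]_(N, r)) (c : k).

Lemma weightX c v i : H *m v = c *: v ->
  H *m (X ^+ i *m v) = (c + (2 * i)%:R) *: (X ^+ i *m v).
Proof.
move=> Hv; elim: i => [|i IHi]; first by rewrite !exp0mx Hv addr0.
rewrite expSmx HX IHi -scalemxAr; move: (X *m _) => u.
by apply/matrixP => a b; rewrite !mxE; ring.
Qed.

Lemma weightY c v i : H *m v = c *: v ->
  H *m (Y ^+ i *m v) = (c - (2 * i)%:R) *: (Y ^+ i *m v).
Proof.
move=> Hv; elim: i => [|i IHi]; first by rewrite !exp0mx Hv subr0.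
rewrite expSmx HY IHi -scalemxAr; move: (Y *m _) => u.
by apply/matrixP => a b; rewrite !mxE; ring.
Qed.

Lemma XY_highest c v i : X *m v = 0 -> H *m v = c *: v ->
  X *m (Y ^+ i.+1 *m v) = (i.+1%:R * (c - i%:R)) *: (Y ^+ i *m v).
Proof.
move=> Xv Hv; elim: i => [|i IHi].
  by rewrite expSmx exp0mx XY Xv mulmx0 add0r Hv subr0 mul1r.
rewrite expSmx XY IHi (weightY _ Hv) -scalemxAr -expSmx.
move: (Y ^+ _ *m _) => u; apply/matrixP => a b; rewrite !mxE; ring.
Qed.

(** The commutator of X^(i+1) and Y, with H moved to the left of X^i. *)
Lemma Xexp_Y i v : X ^+ i.+1 *m (Y *m v) =
  Y *m (X ^+ i.+1 *m v)
  + i.+1%:R *: (H *m (X ^+ i *m v) - i%:R *: (X ^+ i *m v)).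
Proof.
elim: i => [|i IHi].
  by rewrite expr1 exp0mx XY scale0r subr0 scale1r.
rewrite expSmx IHi mulmxDr XY -!expSmx -scalemxAr mulmxBr -scalemxAr.
have -> : X *m (H *m (X ^+ i *m v)) =
          H *m (X ^+ i.+1 *m v) - (X ^+ i.+1 *m v) *+ 2.
  by rewrite [in RHS]expSmx HX addrK.
rewrite -expSmx; set a := Y *m _; set c := X ^+ i.+1 *m v; set b := H *m c.
clearbody a b c.
apply/matrixP => s t; rewrite !mxE; ring.
Qed.

(** H acts as i on ker X meet im X^i modulo im X^(i+1): apply the commutator of
    X^(i+1) and Y to a preimage y of h, noting that X^(i+1) y = X h = 0. *)
Lemma ker_im_step i h y : i.+1%:R != 0 :> k ->
  X *m h = 0 -> h = X ^+ i *m y ->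
  exists y', H *m h - i%:R *: h = X ^+ i.+1 *m y'.
Proof.
move=> i0 Xh hE; exists (i.+1%:R^-1 *: (Y *m y)).
rewrite -scalemxAr Xexp_Y expSmx -hE Xh mulmx0 add0r.
by rewrite scalerA mulVf // scale1r.
Qed.

Lemma XH_ker h : X *m h = 0 -> X *m (H *m h) = 0.
Proof.
move=> Xh; have := HX h; rewrite Xh mulmx0 mul0rn addr0.
by move=> <-.
Qed.

End Vectors.

Variable d : nat.
Hypothesis Xd : X ^+ d = 0.
Hypothesis natr_neq0 : forall i, (0 < i <= 2 * d)%N -> i%:R != 0 :> k.

Let Xge i r (v : 'M[k]_(N, r)) : (d <= i)%N -> X ^+ i *m v = 0.
Proof. by move=> di; rewrite -(subnK di) expDmx Xd mul0mx mulmx0. Qed.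

Lemma natrB_neq0 (i j : nat) : (i < j <= i + 2 * d)%N -> j%:R - i%:R != 0 :> k.
Proof.
move=> /andP[ij jd]; rewrite -natrB ?(ltnW ij) //; apply: natr_neq0.
by rewrite subn_gt0 ij leq_subLR.
Qed.

Section WeightVectors.
Variable r : nat.
Implicit Types (u v h y z : 'M[k]_(N, r)) (c : k).

(** By [ker_im_step], a weight c different from i pushes h from im X^i into
    im X^(i+1); repeating this reaches im X^d = 0. *)
Lemma ker_im_weight0 i c h y : X *m h = 0 -> H *m h = c *: h ->
  h = X ^+ i *m y -> (forall t, (i <= t < d)%N -> c - t%:R != 0) -> h = 0.
Proof.
move=> Xh Hh hE nz.
have step s : exists y', h = X ^+ (i + s) *m y'.
  elim: s => [|s [y' hE']]; first by exists y; rewrite addn0.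
  have [le_d|lt_d] := leqP d (i + s).
    by exists 0; rewrite mulmx0 hE' Xge.
  have [|y2] := ker_im_step _ Xh hE'; first by apply: natr_neq0; lia.
  rewrite Hh -scalerBl => E; exists ((c - (i + s)%:R)^-1 *: y2).
  rewrite -scalemxAr addnS -E scalerA mulVf ?scale1r //.
  by apply: nz; rewrite leq_addr.
by have [y'] := step d; rewrite Xge ?leq_addl.
Qed.

(** The endomorphism H - i of ker X meet im X^i maps into im X^(i+1), where by
    [ker_im_step] its eigenvalues are among 1, ..., d - i - 1.  Removing these
    one after the other, h is corrected modulo im X^(i+1) to an eigenvector of
    eigenvalue i. *)
Lemma highest_correction i h y : (i < d)%N -> X *m h = 0 -> h = X ^+ i *m y ->
  exists h' y', [/\ X *m h' = 0, H *m h' = i%:R *: h' & h' = h + X ^+ i.+1 *m y'].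
Proof.
move=> id Xh hE.
have step s : (s < d)%N -> exists h' y' z,
    [/\ X *m h' = 0, h' = h + X ^+ i.+1 *m y'
      & H *m h' - i%:R *: h' = X ^+ (i + s.+1) *m z].
  elim: s => [|s IHs] sd.
    have [|z E] := ker_im_step _ Xh hE; first by apply: natr_neq0; lia.
    by exists h, 0, z; rewrite mulmx0 addr0 addn1.
  have [h' [y' [z [Xh' h'E E]]]] := IHs (ltnW sd).
  have Xg : X *m (H *m h' - i%:R *: h') = 0.
    by rewrite mulmxBr XH_ker // -scalemxAr Xh' scaler0 subr0.
  have [le_d|lt_d] := leqP d (i + s.+1).
    by exists h', y', 0; split=> //; rewrite E !Xge //; lia.
  have [|y2 E2] := ker_im_step _ Xg E; first by apply: natr_neq0; lia.
  set g := H *m h' - i%:R *: h' in E Xg E2.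
  have s0 : s.+1%:R != 0 :> k by apply: natr_neq0; lia.
  (* H - i sends g to (s+1) g modulo im X^(i+s+2), so subtracting g / (s+1)
     from h' cancels the leading error term. *)
  exists (h' - s.+1%:R^-1 *: g), (y' - s.+1%:R^-1 *: (X ^+ s *m z)),
    (- s.+1%:R^-1 *: y2); split.
  - by rewrite mulmxBr -scalemxAr Xg Xh' scaler0 subr0.
  - rewrite h'E E addnS -addSn expDmx -addrA; congr (_ + _).
    by rewrite mulmxBr -scalemxAr.
  - rewrite addnS -scalemxAr -E2 mulmxBr -scalemxAr.
    have Hh' : H *m h' = g + i%:R *: h' by rewrite subrK.
    rewrite Hh'; move: (H *m g) => a; clearbody g.
    apply/matrixP => u w; rewrite !mxE.
    by field; rewrite nat1r.
by have [h' [y' [z [Xh' h'E E]]]] := step d.-1 ltac:(lia);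
  exists h', y'; split=> //; apply/eqP; rewrite -subr_eq0 E Xge //; lia.
Qed.

(** Up to a nonzero factor the lowest weight vector is Y^(j-1) h.  It is killed
    by Y since Y^j h lies in ker X with weight -(j+1), which differs in k from
    0, ..., d - 1 and so does not occur there by [ker_im_weight0]. *)
Lemma lowest_of_highest j h : (0 < j <= d)%N ->
  X *m h = 0 -> H *m h = j.-1%:R *: h ->
  exists l, [/\ Y *m l = 0, H *m l = (1 - j%:R) *: l & X ^+ j.-1 *m l = h].
Proof.
case: j => // j /= jd Xh Hh.
have XYi i : (i <= j)%N -> exists2 c, c != 0 & X ^+ i *m (Y ^+ i *m h) = c *: h.
  elim: i => [|i IHi] ij; first by exists 1; rewrite ?oner_eq0 // !exp0mx scale1r.
  have [c c0 E] := IHi (ltnW ij).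
  exists (i.+1%:R * (j%:R - i%:R) * c).
    rewrite !mulf_neq0 //; first by apply: natr_neq0; lia.
    by apply: natrB_neq0; lia.
  by rewrite expSrmx (XY_highest _ Xh Hh) -scalemxAr E scalerA.
have [c c0 E] := XYi j (leqnn j).
exists (c^-1 *: (Y ^+ j *m h)); split.
- rewrite -scalemxAr -expSmx (_ : Y ^+ j.+1 *m h = 0) ?scaler0 //.
  apply: (@ker_im_weight0 0 (j%:R - (2 * j.+1)%:R) _ (Y ^+ j.+1 *m h)).
  + by rewrite (XY_highest _ Xh Hh) subrr mulr0 scale0r.
  + exact: weightY Hh.
  + by rewrite exp0mx.
  + move=> t td; rewrite (_ : _ - _ = - (j.+2 + t)%:R); last by ring.
    by rewrite oppr_eq0; apply: natr_neq0; lia.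
- rewrite -scalemxAr (weightY _ Hh) !scalerA; congr (_ *: _).
  by ring.
- by rewrite -scalemxAr E scalerA mulVf // scale1r.
Qed.

Lemma YX_lowest c v i : Y *m v = 0 -> H *m v = c *: v ->
  Y *m (X ^+ i.+1 *m v) = - (i.+1%:R * (c + i%:R)) *: (X ^+ i *m v).
Proof.
move=> Yv Hv; move: (Xexp_Y i v).
rewrite Yv mulmx0 (weightX _ Hv) -scalerBl scalerA.
move/eqP; rewrite eq_sym addr_eq0 => /eqP ->; rewrite -scaleNr.
by congr (_ *: _); ring.
Qed.

Lemma lowest_descend c v i : Y *m v = 0 -> H *m v = c *: v ->
  (forall t, (t < i)%N -> t.+1%:R * (c + t%:R) != 0) ->
  X ^+ i *m v = 0 -> v = 0.
Proof.
move=> Yv Hv; elim: i => [|i IHi] nz; first by rewrite exp0mx.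
move=> Xv; apply: IHi => [t ti|]; first by apply: nz; rewrite ltnS ltnW.
have := YX_lowest i Yv Hv; rewrite Xv mulmx0 => /esym/eqP.
by rewrite scaler_eq0 oppr_eq0 (negbTE (nz _ _)) //= => /eqP.
Qed.

(** X^j v is again killed by Y, with the positive weight 1 + j; by
    [lowest_descend], X^d would not annihilate it if it were nonzero. *)
Lemma lowest_exp_eq0 j v : (0 < j <= d)%N ->
  Y *m v = 0 -> H *m v = (1 - j%:R) *: v -> X ^+ j *m v = 0.
Proof.
move=> jd Yv Hv; apply: (@lowest_descend (1 + j%:R) _ d).
- case: j jd Hv => // j jd Hv; rewrite (YX_lowest _ Yv Hv).
  by rewrite (_ : _ * _ = 0) ?oppr0 ?scale0r //; ring.
- by rewrite (weightX _ Hv); congr (_ *: _); ring.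
- move=> t td; rewrite mulf_neq0 //; first by apply: natr_neq0; lia.
  by rewrite (_ : _ + _ = (1 + j + t)%:R); [apply: natr_neq0; lia | ring].
- by rewrite Xd mul0mx.
Qed.

(** Injectivity of the map from L(j) to the intrinsic quotient: the highest
    vector X^(j-1) v has weight j - 1, which does not occur on
    ker X meet im X^j. *)
Lemma lowest_im_eq0 j v y : (0 < j <= d)%N ->
  Y *m v = 0 -> H *m v = (1 - j%:R) *: v ->
  X ^+ j.-1 *m v = X ^+ j *m y -> v = 0.
Proof.
move=> jd Yv Hv E; apply: (@lowest_descend (1 - j%:R) _ j.-1) => //.
  move=> t tj; rewrite mulf_neq0 //; first by apply: natr_neq0; lia.
  rewrite (_ : _ + _ = t.+1%:R - j%:R); last by ring.
  by rewrite -opprB oppr_eq0; apply: natrB_neq0; lia.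
apply: (@ker_im_weight0 j (1 - j%:R + (2 * j.-1)%:R) _ y).
- by rewrite -expSmx prednK ?(lowest_exp_eq0 _ Yv Hv) //; case/andP: jd.
- exact: weightX Hv.
- exact: E.
- move=> t td; rewrite (_ : _ - _ = - (t.+1%:R - j%:R)).
    by rewrite oppr_eq0; apply: natrB_neq0; lia.
  by case: (j) jd => // i _; rewrite /=; ring.
Qed.

(** Surjectivity of the map from L(j) to the intrinsic quotient: u and l have
    the same class, since u - l + X y is killed by X^(j-1). *)
Lemma exists_lowest j u : (0 < j <= d)%N -> X ^+ j *m u = 0 ->
  exists l y, [/\ Y *m l = 0, H *m l = (1 - j%:R) *: l
                & X ^+ j.-1 *m l = X ^+ j.-1 *m u + X ^+ j *m y].
Proof.
move=> jd Xu; have j0 : (0 < j)%N by case/andP: jd.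
have [||h [y [Xh Hh hE]]] :=
  @highest_correction j.-1 (X ^+ j.-1 *m u) u _ _ erefl.
- by lia.
- by rewrite -expSmx prednK.
have [l [Yl Hl lE]] := lowest_of_highest jd Xh Hh.
by exists l, y; rewrite lE hE prednK.
Qed.

End WeightVectors.
End Sl2.

(** * The lowest weight space of an isotypic component *)
Section Isotypic.
Variables (k : fieldType) (n d : nat) (X Y H : 'M[k]_(n + n)).
Hypothesis sl2 : sl2_relations X Y H.
Hypothesis Xd : X ^+ d = 0.
Hypothesis natr_neq0 : forall i, (0 < i <= 2 * d)%N -> i%:R != 0 :> k.

Section String.
Variables (j : nat) (v : 'cV[k]_(n + n)).
Hypotheses (jd : (0 < j <= d)%N) (Yv : Y *m v = 0).
Hypotheses (Hv : H *m v = (1 - j%:R) *: v) (v0 : v != 0).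

Let string := [tuple X ^+ i *m v | i < j].

Let nth_string (i : 'I_j) : string`_i = X ^+ i *m v.
Proof. by rewrite -tnth_nth tnth_mktuple. Qed.

Let Yexp_lt t i : (t < i)%N -> Y ^+ i *m (X ^+ t *m v) = 0.
Proof.
elim: i t => // i IHi [|t] ti; first by rewrite exp0mx expSrmx Yv mulmx0.
by rewrite expSrmx (YX_lowest sl2 _ Yv Hv) -scalemxAr IHi // scaler0.
Qed.

Let Yexp_diag i : (i < j)%N ->
  exists2 a, a != 0 & Y ^+ i *m (X ^+ i *m v) = a *: v.
Proof.
elim: i => [|i IHi] ij; first by exists 1; rewrite ?oner_eq0 // !exp0mx scale1r.
have [a a0 E] := IHi (ltnW ij).
exists (- (i.+1%:R * (1 - j%:R + i%:R)) * a).
  rewrite mulf_neq0 // oppr_eq0 mulf_neq0 //; first by apply: natr_neq0; lia.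
  rewrite (_ : _ + _ = i.+1%:R - j%:R); last by ring.
  by rewrite -opprB oppr_eq0; apply: (natrB_neq0 natr_neq0); lia.
by rewrite expSrmx (YX_lowest sl2 _ Yv Hv) -scalemxAr E scalerA.
Qed.

(* A power of Y isolates the coefficient of the highest X^i v involved. *)
Let Yexp_comb (c : 'I_j -> k) (i0 : 'I_j) : c i0 != 0 ->
  exists i a, a != 0 /\ Y ^+ i *m (\sum_i c i *: (X ^+ i *m v)) = a *: v.
Proof.
move=> ci0; have [i ci imax] :=
  @arg_maxnP _ i0 (fun i => c i != 0) (fun i : 'I_j => (i : nat)) ci0.
have [a a0 E] := Yexp_diag (ltn_ord i).
exists i, (c i * a); split; first by rewrite mulf_neq0.
rewrite mulmx_sumr (bigD1 i) //= -scalemxAr E scalerA big1 ?addr0 // => t ti.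
rewrite -scalemxAr; have [->|ct] := eqVneq (c t) 0; first by rewrite scale0r.
rewrite Yexp_lt ?scaler0 // ltn_neqAle.
by have -> : (t <= i)%N := imax t ct; rewrite andbT.
Qed.

Let string_coord u : u \in <<string>>%VS ->
  exists c : 'I_j -> k, u = \sum_i c i *: (X ^+ i *m v).
Proof.
move=> /coord_span ->; exists (fun i => coord string i u).
by apply: eq_bigr => i _; rewrite nth_string.
Qed.

Let mem_string i : X ^+ i *m v \in <<string>>%VS.
Proof.
have [ij|ji] := ltnP i j.
  by apply/memv_span/tnthP; exists (Ordinal ij); rewrite tnth_mktuple.
rewrite -(subnK ji) expDmx (lowest_exp_eq0 sl2 Xd natr_neq0 jd Yv Hv) mulmx0.
exact: mem0v.
Qed.

Let string_submodule : sl2_submodule Y H X <<string>>%VS.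
Proof.
move=> u /string_coord [c ->]; rewrite !mulmx_sumr.
split; apply: memv_suml => i _; rewrite -scalemxAr memvZ //.
- case: (i : nat) => [|t]; first by rewrite exp0mx Yv mem0v.
  by rewrite (YX_lowest sl2 _ Yv Hv) memvZ.
- by rewrite (weightX sl2 _ Hv) memvZ.
- by rewrite -expSmx.
Qed.

Let string_dim : \dim <<string>>%VS = j.
Proof.
rewrite -[RHS](size_tuple string); apply/eqP; rewrite -/(free string).
apply/freeP => c E i; apply/eqP/negPn/negP => /Yexp_comb [t [a [a0]]].
rewrite (_ : \sum_i _ = 0) ?mulmx0.
  by move/esym/eqP; rewrite scaler_eq0 (negbTE a0) (negbTE v0).
by rewrite -[RHS]E; apply: eq_bigr => s _; rewrite nth_string.
Qed.

Lemma string_irreducible : exists U : {vspace 'cV[k]_(n + n)},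
  [/\ sl2_irreducible Y H X U, \dim U = j & v \in U].
Proof.
exists <<string>>%VS; split=> //; last by rewrite -[v](exp0mx X) mem_string.
have j0 : (0 < j)%N by case/andP: jd.
split=> // [|W subW WU]; first by rewrite -dimv_eq0 string_dim -lt0n.
have [->|W0] := eqVneq W 0%VS; [by left | right].
apply/eqP; rewrite eqEsubv WU /=.
have wW := memv_pick W; have w0 : vpick W != 0 by rewrite vpick0.
have [c cE] := string_coord (subvP WU _ wW).
have [i0 ci0] : exists i, c i != 0.
  apply/existsP; apply: contraR w0 => /existsPn c0; rewrite cE big1 // => i _.
  by have /negPn/eqP-> := c0 i; rewrite scale0r.
have [i [a [a0 E]]] := Yexp_comb ci0.
have YW t u : u \in W -> Y ^+ t *m u \in W.
  by move=> uW; elim: t => [|t /subW[]]; rewrite ?exp0mx // -expSmx.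
have XW t u : u \in W -> X ^+ t *m u \in W.
  by move=> uW; elim: t => [|t /subW[]]; rewrite ?exp0mx // -expSmx.
have vW : v \in W.
  have := YW i _ wW; rewrite cE E => /(memvZ a^-1).
  by rewrite scalerA mulVf // scale1r.
apply/span_subvP => _ /(nthP 0) [t tj <-].
move: tj; rewrite size_tuple card_ord => tj.
by have := XW t v vW; rewrite -[X ^+ t *m v](nth_string (Ordinal tj)).
Qed.

End String.

(** A nonzero v with Y v = 0 and H v = (1 - j) v spans, together with its images
    under X, an irreducible submodule of dimension j, so the membership of v in
    the isotypic component is automatic. *)
Lemma in_lowestP j v : (0 < j <= d)%N ->
  in_lowest Y H X j v <-> Y *m v = 0 /\ H *m v = (1 - j%:R) *: v.
Proof.
move=> jd; split=> [[] //|[Yv Hv]]; split=> //.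
have [->|v0] := eqVneq v 0.
  by exists 0%N, (fun=> 0%VS); split=> [[]//|]; exact: mem0v.
have [U [irr dimU vU]] := string_irreducible jd Yv Hv v0.
by exists 1%N, (fun=> U); rewrite big_ord1.
Qed.

End Isotypic.

(** * Jordan chains *)
Lemma jordan_block_exp (R : pzRingType) N t (a b : 'I_N) :
  (jordan_block R N ^+ t) a b = (b == a + t :> nat)%N%:R.
Proof.
elim: t a b => [|t IHt] a b.
  by rewrite expr0 mxE addn0 eq_sym -val_eqE.
rewrite exprS -mulmxE mxE.
have [aN|Na] := ltnP a.+1 N.
  rewrite (bigD1 (Ordinal aN)) //= big1 ?addr0 => [|c].
    by rewrite IHt mxE /= eqxx mul1r addSnnS.
  by rewrite mxE -val_eqE /= => /negbTE->; rewrite mul0r.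
rewrite big1 => [|c _]; last first.
  rewrite mxE (_ : (_ == _) = false) ?mul0r //.
  by apply/eqP => E; move: (ltn_ord c); rewrite E ltnNge Na.
rewrite (_ : (_ == _) = false) //; apply/eqP => E.
by move: (ltn_ord b); rewrite E addnS ltnNge (leq_trans Na) // ltnS leq_addr.
Qed.

Section Chain.
Variables (k : fieldType) (N : nat) (X : 'M[k]_N).

(** The chain is listed from its last vector down to its generator g, as in a
    Jordan basis for upper triangular blocks acting on columns. *)
Definition chain_mx (l : nat) (g : 'cV[k]_N) : 'M[k]_(N, l) :=
  \matrix_(u < N, a < l) (X ^+ (l.-1 - a) *m g) u 0.

Lemma col_chain_mx l g a : col a (chain_mx l g) = X ^+ (l.-1 - a) *m g.
Proof. by apply/matrixP => u b; rewrite !mxE !ord1. Qed.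

Lemma chain_mx_mul l g (c : 'cV[k]_l) :
  chain_mx l g *m c = \sum_(a < l) c a 0 *: (X ^+ (l.-1 - a) *m g).
Proof.
apply/colP => u; rewrite [LHS]mxE summxE; apply: eq_bigr => a _.
by rewrite [RHS]mxE [X in X * _ = _]mxE mulrC.
Qed.

Lemma mul_chain_mx l g : X ^+ l *m g = 0 ->
  X *m chain_mx l g = chain_mx l g *m jordan_block k l.
Proof.
move=> Xg; apply/matrixP => u b.
transitivity ((X ^+ (l.-1 - b).+1 *m g) u 0).
  by rewrite expSmx -col_chain_mx !mxE; apply: eq_bigr => a _; rewrite !mxE.
rewrite [RHS]mxE; case: b => -[|b] lb /=.
  rewrite subn0 prednK // Xg mxE big1 // => a _.
  by rewrite [X in _ * X]mxE mulr0.
rewrite (bigD1 (Ordinal (ltnW lb))) //= big1 ?addr0 => [|a]; last first.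
  by rewrite -val_eqE [X in _ * X]mxE eqSS eq_sym => /negbTE /= ->; rewrite mulr0.
rewrite [jordan_block _ _ _ _]mxE eqxx mulr1 [RHS]mxE.
by congr ((_ ^+ _ *m _) _ _); rewrite /=; lia.
Qed.

Lemma exp_mul_chain_mx l g j : X ^+ l *m g = 0 ->
  X ^+ j *m chain_mx l g = chain_mx l g *m jordan_block k l ^+ j.
Proof.
move=> Xg; elim: j => [|j IHj]; first by rewrite !expr0 mul1mx mulmx1.
by rewrite expSmx IHj mulmxA mul_chain_mx // exprS -mulmxE mulmxA.
Qed.

(** A combination of the chain killed by X^j contributes to X^(j-1) (ker X^j)
    modulo im X^j only when the chain has length exactly j: a shorter chain is
    killed by X^(j-1), and in a longer one the generator cannot occur. *)
Lemma chain_mx_top l g j (c : 'cV[k]_l) : (0 < j)%N -> X ^+ l *m g = 0 ->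
  jordan_block k l ^+ j *m c = 0 ->
  exists y, X ^+ j.-1 *m (chain_mx l g *m c) = X ^+ j *m y \/
    l = j /\ exists a, X ^+ j.-1 *m (chain_mx l g *m c)
                       = a *: (X ^+ j.-1 *m g) + X ^+ j *m y.
Proof.
case: j => // j _ Xg /=; case: l => [|l] in c Xg *.
  by move=> _; exists 0; left; rewrite chain_mx_mul big_ord0 !mulmx0.
move=> Jc; 
pose y := \sum_(a < l) c (widen_ord (leqnSn l) a) 0 *: (X ^+ (l.-1 - a) *m g).
have cE : chain_mx l.+1 g *m c = c ord_max 0 *: g + X *m y.
  rewrite chain_mx_mul big_ord_recr /= subnn exp0mx addrC; congr (_ + _).
  rewrite mulmx_sumr; apply: eq_bigr => a _.
  rewrite -scalemxAr -expSmx; congr (_ *: (_ ^+ _ *m _)).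
  by move: (ltn_ord a) => /=; lia.
rewrite cE; exists y; rewrite mulmxDr -scalemxAr -expSrmx.
have [lj|jl|lj] := ltngtP l j.
- left; rewrite -(subnK lj) expDmx Xg mulmx0 scaler0 add0r //.
- left; rewrite (_ : c ord_max 0 = 0) ?scale0r ?add0r //.
  have lt_a : (l - j.+1 < l.+1)%N by lia.
  move/matrixP/(_ (Ordinal lt_a) 0): Jc; rewrite !mxE => <-.
  rewrite (bigD1 ord_max) //= jordan_block_exp /= subnK // eqxx mul1r.
  rewrite big1 ?addr0 // => b bl; rewrite jordan_block_exp /= subnK //.
  by rewrite -[l in _ == l]/(val (@ord_max l)) val_eqE (negbTE bl) mul0r.
- by right; split; [rewrite lj | exists (c ord_max 0)].
Qed.

End Chain.

(** An occurrence of j in la is determined by the number of earlier ones; this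
    matches the chains of a Jordan basis, listed along la, with the columns of
    the generator matrices, listed for each j. *)
Lemma count_mem_nth (la : seq nat) j b : (b < count_mem j la)%N ->
  exists i : 'I_(size la), nth 0%N la i = j /\ count_mem j (take i la) = b.
Proof.
elim: la b => // x la IHla b /=; have [->|xj] := eqVneq x j.
  case: b => [|b]; first by exists ord0.
  rewrite add1n ltnS => /IHla [i [ij ib]].
  by exists (lift ord0 i); rewrite /= eqxx ib.
rewrite add0n => /IHla [i [ij ib]].
by exists (lift ord0 i); rewrite /= (negbTE xj).
Qed.

(** A Jordan basis has sum-of-parts many columns, a number equal but not
    convertible to the dimension; hence the casts. *)
Section SquareUpToCast.
Variables (k : fieldType) (N M : nat) (P : 'M[k]_(N, M)) (e : M = N).
Hypothesis P_free : forall r (l : 'M[k]_(r, N)), l *m P = 0 -> l = 0.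

Lemma similar_cast (X : 'M[k]_N) (D : 'M[k]_M) : X *m P = P *m D ->
  exists2 S : 'M[k]_N, S \in unitmx &
    S *m X *m invmx S = castmx (e, e) D.
Proof.
case: N / e X P P_free => X P' free XP.
have P'u : P' \in unitmx.
  by rewrite -row_free_unit -kermx_eq0; apply/eqP/free/mulmx_ker.
exists (invmx P'); first by rewrite unitmx_inv.
by rewrite invmxK castmx_id -mulmxA XP mulKmx.
Qed.

Lemma inj_onto_cast :
  (forall r (c : 'M[k]_(M, r)), P *m c = 0 -> c = 0) /\
  (forall r (z : 'M[k]_(N, r)), exists c, z = P *m c).
Proof.
case: N / e P P_free => P' free.
have P'u : P' \in unitmx.
  by rewrite -row_free_unit -kermx_eq0; apply/eqP/free/mulmx_ker.
split=> [r c|r z]; last by exists (invmx P' *m z); rewrite mulKVmx.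
by move/(congr1 (mulmx (invmx P'))); rewrite mulKmx // mulmx0.
Qed.

End SquareUpToCast.

(** * The symplectic form *)
Section SymplecticForm.
Variables (k : fieldType) (n : nat).
Local Notation J := (Jmx k n).

Lemma Jmx_unit : J \in unitmx.
Proof.
have : (- J) *m J = 1%:M.
  rewrite /Jmx mulNmx mulmx_block !mul0mx !mulmx0 !add0r !addr0 mul1mx mulmx1.
  by rewrite opp_block_mx !opprK !oppr0 -scalar_mx_block.
by case/mulmx1_unit.
Qed.

Lemma sp_tr (A : 'M[k]_(n + n)) : sp A -> A^T *m J = - (J *m A).
Proof. by move/eqP; rewrite addr_eq0 => /eqP. Qed.

Lemma sp_move (A : 'M[k]_(n + n)) i r s (v : 'M_(n + n, r)) (u : 'M_(n + n, s)) :
  sp A -> (A ^+ i *m v)^T *m J *m u = (-1) ^+ i *: (v^T *m J *m (A ^+ i *m u)).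
Proof.
move=> spA; elim: i v => [|i IHi] v; first by rewrite !exp0mx scale1r.
rewrite expSrmx IHi trmx_mul -!mulmxA (mulmxA A^T) sp_tr //.
rewrite expSmx exprS mulN1r scaleNr !mulNmx mulmxN scalerN.
by rewrite !mulmxA.
Qed.

Lemma form_entry r s (v : 'M[k]_(n + n, r)) (u : 'M_(n + n, s)) a b :
  sform (col a v) (col b u) = (v^T *m J *m u) a b.
Proof. by rewrite /sform tr_col -!row_mul mxE colE mulmxA -colE mxE. Qed.

End SymplecticForm.

Lemma col_matrixP (R : Type) m r (A B : 'M[R]_(m, r)) :
  (forall b, col b A = col b B) -> A = B.
Proof.
move=> AB; apply/trmx_inj/row_matrixP => b.
by rewrite -!tr_col AB.
Qed.

Lemma col_mulmx (R : pzSemiRingType) m r s (A : 'M[R]_(m, r)) (B : 'M_(r, s)) b :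
  col b (A *m B) = A *m col b B.
Proof. by rewrite !colE mulmxA. Qed.

(** * Jordan generators *)
Section Generators.
Variables (k : fieldType) (n : nat) (la : seq nat).
Hypothesis la_part : is_partition n.*2 la.
Variables (X : 'M[k]_(n + n)) (W : forall j, 'M[k]_(n + n, mult la j)).
Local Notation J := (Jmx k n).

(** Spanning is expressed by duality, as the absence of nonzero linear forms
    vanishing on all X^t W_j. *)
Definition jordan_generators : Prop :=
  (forall j, (0 < j <= n.*2)%N -> X ^+ j *m W j = 0) /\
  (forall r (l : 'M[k]_(r, n + n)),
    (forall j t, (0 < j <= n.*2)%N -> l *m (X ^+ t *m W j) = 0) -> l = 0).

Hypothesis gen : jordan_generators.

Lemma generators_nilpotent : X ^+ n.*2 = 0.
Proof.
case: gen => XW span; apply: span => j t jn.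
rewrite -expDmx -(subnK (_ : j <= n.*2 + t)%N); last first.
  by apply: leq_trans (leq_addr _ _); case/andP: jn.
by rewrite expDmx XW // mulmx0.
Qed.

Let part i := nth 0%N la i.

Let gen_col (i : 'I_(size la)) : 'cV[k]_(n + n) :=
  W (part i) *m \col_b (b == count_mem (part i) (take i la) :> nat)%:R.

Let gen_colE (i : 'I_(size la)) j (b : 'I_(mult la j)) :
  part i = j -> count_mem j (take i la) = b -> gen_col i = col b (W j).
Proof.
rewrite /gen_col => E; case: j / E b => b ->; rewrite colE; congr (_ *m _).
by apply/colP => a; rewrite !mxE eqxx andbT.
Qed.

Let gen_colW (i : 'I_(size la)) j : part i = j -> exists d, gen_col i = W j *m d.
Proof. by rewrite /gen_col => <-; eexists. Qed.

Let partP (i : 'I_(size la)) : (0 < part i <= n.*2)%N.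
Proof.
case: la_part => _ /allP la_gt0 <-; have il := mem_nth 0%N (ltn_ord i).
rewrite (la_gt0 _ il) /=; move: (perm_to_rem il) => /perm_sumn ->.
by rewrite /= leq_addr.
Qed.

Let X_gen_col (i : 'I_(size la)) : X ^+ part i *m gen_col i = 0.
Proof. by case: gen => XW _; rewrite mulmxA XW ?mul0mx. Qed.

Let P := \mxrow_(i < size la) chain_mx X (nth 0%N la i) (gen_col i).

Let sizeP : (\sum_(i < size la) nth 0 la i)%N = (n + n)%N.
Proof.
rewrite -(big_mkord xpredT (nth 0%N la)) -(big_nth 0%N xpredT id) -sumnE.
by case: la_part => _ _ ->; rewrite addnn.
Qed.

(* The Jordan basis matrix contains every X^t W_j with t < j. *)
Let P_free r (l : 'M[k]_(r, n + n)) : l *m P = 0 -> l = 0.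
Proof.
rewrite mul_mxrow -mxrow0 => /eq_mxrowP lP.
case: gen => XW span; apply: span => j t jn.
have [jt|tj] := leqP j t; first by rewrite -(subnK jt) expDmx XW // !mulmx0.
apply: col_matrixP => b; have [i [ij ib]] := count_mem_nth (ltn_ord b).
have lt_a : (j.-1 - t < nth 0%N la i)%N by rewrite ij; lia.
have := congr1 (col (Ordinal lt_a)) (lP i).
rewrite !col_mulmx col_chain_mx (gen_colE ij ib) /=.
by rewrite (_ : (nth 0 la i).-1 - _ = t)%N ?col0 // ij; lia.
Qed.

Lemma generators_jordan_type : has_jordan_type la X.
Proof.
exists sizeP; apply: (similar_cast (P := P) sizeP P_free).
rewrite mul_mxrow mul_mxrow_mxdiag; apply: eq_mxrow => i.
exact/mul_chain_mx/X_gen_col.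
Qed.

(** The W_j span the intrinsic quotient: expand z in the Jordan basis and apply
    [chain_mx_top] to each chain. *)
Lemma ker_exp_generators j z : (0 < j <= n.*2)%N -> X ^+ j *m z = 0 ->
  exists (c : 'cV_(mult la j)) y,
    X ^+ j.-1 *m z = X ^+ j.-1 *m (W j *m c) + X ^+ j *m y.
Proof.
move=> /andP[j0 jn] Xz; have [P_inj P_onto] := inj_onto_cast sizeP P_free.
have [c zE] := P_onto _ z; pose ci i := submxcol c i.
have cE : c = \mxcol_i ci i by rewrite submxcolK.
have Jc (i : 'I_(size la)) : jordan_block k (nth 0%N la i) ^+ j *m ci i = 0.
  have : P *m (\mxcol_i (jordan_block k (nth 0%N la i) ^+ j *m ci i)) = 0.
    rewrite -[RHS]Xz zE cE !mul_mxrow_mxcol mulmx_sumr; apply: eq_bigr => u _.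
    by rewrite !mulmxA exp_mul_chain_mx //; exact: X_gen_col.
  by move/P_inj/(congr1 (fun A => submxcol A i)); rewrite mxcolK submxcol0.
rewrite zE cE mul_mxrow_mxcol mulmx_sumr.
pose T v := exists (d : 'cV_(mult la j)) y,
  v = X ^+ j.-1 *m (W j *m d) + X ^+ j *m y.
rewrite -/(T _); apply: (big_ind T) => [|u v [d [y ->]] [d' [y' ->]]|i _].
- by exists 0, 0; rewrite !mulmx0 addr0.
- by exists (d + d'), (y + y'); rewrite !mulmxDr addrACA.
have [y [->|[ij [a ->]]]] := chain_mx_top j0 (X_gen_col i) (Jc i).
  by exists 0, y; rewrite !mulmx0 add0r.
have [d ->] := gen_colW ij; exists (a *: d), y.
by rewrite -!scalemxAr.
Qed.

End Generators.

Section FormShift.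
Variables (k : fieldType) (n : nat) (A : 'M[k]_(n + n)) (i r s : nat).
Hypothesis spA : sp A.
Implicit Types (v : 'M[k]_(n + n, r)) (u : 'M[k]_(n + n, s)).
Local Notation J := (Jmx k n).

Lemma sp_move_r v u :
  v^T *m J *m (A ^+ i *m u) = (-1) ^+ i *: ((A ^+ i *m v)^T *m J *m u).
Proof. by rewrite sp_move // scalerA -exprMn mulrNN mulr1 expr1n scale1r. Qed.

Lemma form_ker_l v u : A ^+ i *m v = 0 -> v^T *m J *m (A ^+ i *m u) = 0.
Proof. by rewrite sp_move_r => ->; rewrite trmx0 !mul0mx scaler0. Qed.

Lemma form_ker_r v u : A ^+ i *m u = 0 -> (A ^+ i *m v)^T *m J *m u = 0.
Proof. by move=> Au; rewrite sp_move // Au mulmx0 scaler0. Qed.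

End FormShift.

Lemma lie_triple_sl2 (k : fieldType) n (X Y H : 'M[k]_(n + n)) :
  lie_triple Y H X -> sl2_relations X Y H.
Proof. by case=> _ [hX hY hH]; split. Qed.

(** * The form attached to a Lie triple *)
Section LowestForm.
Variables (k : fieldType) (n : nat) (la : seq nat).
Hypothesis la_part : is_partition n.*2 la.
Hypothesis natr_neq0 : forall i, (0 < i <= 2 * n.*2)%N -> i%:R != 0 :> k.
Variables (X : 'M[k]_(n + n)) (W : forall j, 'M[k]_(n + n, mult la j)).
Hypotheses (spX : sp X) (gen : jordan_generators X W).
Local Notation J := (Jmx k n).

(** [exists_lowest] moves the columns of W_j to lowest weight vectors L without
    changing their classes in the intrinsic quotient, hence with the same Gram
    matrix.  The vectors L span L(j): the part z of v orthogonal to them has the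
    class of W_j c' by [ker_exp_generators]; nondegeneracy of the Gram matrix
    forces c' = 0, and [lowest_im_eq0] then z = 0. *)
Lemma lowest_form_generators Y H j (q q' : 'M[k]_(mult la j)) :
  (0 < j <= n.*2)%N -> lie_triple Y H X ->
  (W j)^T *m J *m (X ^+ j.-1 *m W j) = q' -> q' \in unitmx ->
  isometric q q' -> lowest_form_isometric Y H X j q.
Proof.
move=> jn /lie_triple_sl2 sl2 Wq q'u [g gu qE].
have Xd := generators_nilpotent gen.
have XW : X ^+ j *m W j = 0 by case: gen => XW _; exact: XW.
have [L [y [YL HL LE]]] := exists_lowest sl2 Xd natr_neq0 jn XW.
have XL : X ^+ j *m L = 0 := lowest_exp_eq0 sl2 Xd natr_neq0 jn YL HL.
have Lq : L^T *m J *m (X ^+ j.-1 *m L) = q'.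
  rewrite LE mulmxDr (form_ker_l spX _ XL) addr0 sp_move_r // LE linearD /=.
  by rewrite !mulmxDl (form_ker_r spX _ XW) addr0 -sp_move_r.
pose B := L *m invmx g.
have Bq : B^T *m J *m (X ^+ j.-1 *m B) = q.
  transitivity ((invmx g)^T *m (L^T *m J *m (X ^+ j.-1 *m L)) *m invmx g).
    by rewrite /B trmx_mul !mulmxA.
  by rewrite Lq -qE trmx_inv -!mulmxA mulmxV // mulmx1 mulKmx ?unitmx_tr.
have qu : q \in unitmx by move: q'u; rewrite -qE !unitmx_mul => /andP[/andP[]].
exists B; split=> [|v|a b].
- apply/eqP; rewrite eqn_leq rank_leq_col -{1}(mxrank_unit qu) -Bq mulmxA.
  exact: mxrankM_maxr.
- rewrite (in_lowestP sl2 Xd natr_neq0) //; split=> [[Yv Hv]|[c ->]]; last first.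
    by rewrite /B !mulmxA YL HL !mul0mx -!scalemxAl.
  pose c := invmx q' *m (L^T *m J *m (X ^+ j.-1 *m v)).
  pose z := v - L *m c.
  suff z0 : z = 0.
    exists (g *m c); rewrite mulmxA mulmxKV //.
    by apply/eqP; rewrite -subr_eq0 -/z z0.
  have Yz : Y *m z = 0 by rewrite mulmxBr Yv mulmxA YL mul0mx subr0.
  have Hz : H *m z = (1 - j%:R) *: z.
    by rewrite mulmxBr Hv mulmxA HL scalerBr scalemxAl.
  have Lz : L^T *m J *m (X ^+ j.-1 *m z) = 0.
    rewrite !mulmxBr (mulmxA (X ^+ j.-1) L) (mulmxA (L^T *m J) (X ^+ j.-1 *m L)).
    by rewrite Lq mulKVmx // subrr.
  have Xz : X ^+ j *m z = 0 := lowest_exp_eq0 sl2 Xd natr_neq0 jn Yz Hz.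
  have [c' [y' zE]] := ker_exp_generators la_part gen jn Xz.
  have Wz : (W j)^T *m J *m (X ^+ j.-1 *m z) = 0.
    move/eqP: LE; rewrite -subr_eq => /eqP LE.
    rewrite sp_move_r // -LE [(_ - _)^T]linearB /= !mulmxBl.
    by rewrite (form_ker_r spX _ Xz) subr0 -sp_move_r.
  have c'0 : c' = 0.
    move: Wz; rewrite zE mulmxDr (form_ker_l spX _ XW) addr0.
    rewrite (mulmxA (X ^+ j.-1) (W j)).
    rewrite (mulmxA ((W j)^T *m J) (X ^+ j.-1 *m W j)) Wq.
    by move/(congr1 (mulmx (invmx q'))); rewrite mulKmx // mulmx0.
  apply: (lowest_im_eq0 sl2 Xd natr_neq0 jn Yz Hz (y := y')).
  by rewrite zE c'0 !mulmx0 add0r.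
- by rewrite -col_mulmx form_entry Bq.
Qed.

End LowestForm.

(** * Orbits *)
Section ScalarExtension.
Variables (k K : fieldType) (iota : {rmorphism k -> K}) (n : nat).
Implicit Types A : 'M[k]_(n + n).

Lemma map_Jmx : map_mx iota (Jmx k n) = Jmx K n.
Proof. by rewrite /Jmx map_block_mx map_mxN map_mx1 map_mx0. Qed.

Lemma map_jordan_mx la : map_mx iota (jordan_mx k la) = jordan_mx K la.
Proof.
have mapJ N : jordan_block K N = map_mx iota (jordan_block k N).
  by apply/matrixP => a b; rewrite !mxE rmorph_nat.
apply/matrixP => a b; rewrite !mxE; case: ifP => _; rewrite ?mxE ?rmorph0 //.
by rewrite mapJ -(map_mx0 iota) -map_conform_mx mxE.
Qed.

Lemma rational_nil_orbit_of la A :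
  sp A -> (exists N, A ^+ N = 0) -> has_jordan_type la A ->
  rational_nil_orbit iota la A.
Proof.
move=> spA [N AN] [e [P Pu PE]]; split=> //; split.
- by rewrite /sp -map_Jmx map_trmx -!map_mxM -map_mxD spA map_mx0.
- exists N; rewrite -(map_mx0 iota) -AN; elim: (N) => [|i IHi].
    by rewrite !expr0 map_mx1.
  by rewrite !exprS IHi -!mulmxE map_mxM.
- exists e; exists (map_mx iota P); first by rewrite map_unitmx.
  by rewrite -map_invmx -!map_mxM PE map_castmx map_jordan_mx.
Qed.

End ScalarExtension.

Section Conjugation.
Variables (k : fieldType) (n : nat) (g : 'M[k]_(n + n)).
Hypothesis Sp_g : Sp g.
Implicit Types A B X Y H : 'M[k]_(n + n).

Lemma Sp_unit : g \in unitmx.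
Proof.
have : Jmx k n \in unitmx := Jmx_unit k n.
by rewrite -[X in X \in _]Sp_g !unitmx_mul => /andP[].
Qed.

Definition conj_mx A := g *m A *m invmx g.

Lemma conj_mxM A B : conj_mx A *m conj_mx B = conj_mx (A *m B).
Proof. by rewrite /conj_mx -!mulmxA mulKmx ?Sp_unit. Qed.

Lemma conj_mxB A B : conj_mx (A - B) = conj_mx A - conj_mx B.
Proof. by rewrite /conj_mx mulmxBr mulmxBl. Qed.

Lemma conj_mx_exp A i r (v : 'M_(n + n, r)) :
  conj_mx A ^+ i *m (g *m v) = g *m (A ^+ i *m v).
Proof.
elim: i => [|i IHi]; first by rewrite !exp0mx.
by rewrite !expSmx IHi /conj_mx -!mulmxA mulKmx ?Sp_unit.
Qed.

Lemma conj_mx_sp A : sp A -> sp (conj_mx A).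
Proof.
move=> spA; have gu := Sp_unit.
have : g^T *m ((conj_mx A)^T *m Jmx k n + Jmx k n *m conj_mx A) *m g = 0.
  have -> : g^T *m ((conj_mx A)^T *m Jmx k n + Jmx k n *m conj_mx A) *m g
          = A^T *m (g^T *m Jmx k n *m g) + g^T *m Jmx k n *m g *m A.
    rewrite /conj_mx !trmx_mul mulmxDr mulmxDl !mulmxA -trmx_mul mulVmx //.
    by rewrite trmx1 mul1mx mulmxKV.
  by rewrite Sp_g spA.
rewrite /sp; move: (_ + _) => S.
move/(congr1 (fun B => invmx g^T *m B *m invmx g)).
by rewrite mulmx0 mul0mx -!mulmxA mulmxV // mulmx1 mulKmx ?unitmx_tr.
Qed.

Lemma conj_lie_triple Y H X :
  lie_triple Y H X -> lie_triple (conj_mx Y) (conj_mx H) (conj_mx X).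
Proof.
have conjM2 A : conj_mx A *+ 2 = conj_mx (A *+ 2).
  by rewrite /conj_mx mulmxDr mulmxDl.
have conjN A : - conj_mx A = conj_mx (- A).
  by rewrite /conj_mx mulmxN mulNmx.
case=> -[spY spH spX] [hX hY hH]; split; first by split; exact: conj_mx_sp.
rewrite /bracket !conj_mxM -!conj_mxB !conjM2 conjN.
by move: hX hY hH; rewrite /bracket => -> -> ->.
Qed.

Lemma conj_generators la X (W : forall j, 'M[k]_(n + n, mult la j)) :
  jordan_generators X W -> jordan_generators (conj_mx X) (fun j => g *m W j).
Proof.
case=> XW span; split=> [j jn|r l lW]; first by rewrite conj_mx_exp XW // mulmx0.
have lg0 : l *m g = 0.
  by apply: span => j t jn; rewrite -mulmxA -conj_mx_exp lW.
by rewrite -[l](mulmxK Sp_unit) lg0 mul0mx.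
Qed.

Lemma conj_form X i r (v : 'M_(n + n, r)) :
  (g *m v)^T *m Jmx k n *m (conj_mx X ^+ i *m (g *m v))
  = v^T *m Jmx k n *m (X ^+ i *m v).
Proof. by rewrite conj_mx_exp -{2}Sp_g trmx_mul !mulmxA. Qed.

End Conjugation.

Section Orbit.
Variables (k K : fieldType) (iota : {rmorphism k -> K}).
Variables (n : nat) (la : seq nat).
Hypothesis la_part : is_partition n.*2 la.
Hypothesis natr_neq0 : forall i, (0 < i <= 2 * n.*2)%N -> i%:R != 0 :> k.
Variables (cQ Q : forall j : nat, 'M[k]_(mult la j)).
Hypothesis cQQ : forall j, ~~ odd j -> (2 <= j <= n.*2)%N ->
  Q j \in unitmx /\ isometric (cQ j) (Q j).

Definition normal_generators X (W : forall j, 'M[k]_(n + n, mult la j)) : Prop :=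
  jordan_generators X W /\
  forall j, ~~ odd j -> (2 <= j <= n.*2)%N ->
    (W j)^T *m Jmx k n *m (X ^+ j.-1 *m W j) = Q j.

(** A conjugation-invariant certificate that the orbit of X corresponds to the
    forms Q. *)
Definition is_normal X : Prop :=
  (exists Y H, lie_triple Y H X) /\ exists W, normal_generators X W.

Lemma conj_normal g X : Sp g -> is_normal X -> is_normal (conj_mx g X).
Proof.
move=> Sp_g [[Y [H YHX]] [W [gen WQ]]]; split.
  by exists (conj_mx g Y), (conj_mx g H); exact: conj_lie_triple.
exists (fun j => g *m W j); split; first exact: conj_generators.
by move=> j je jn; rewrite conj_form // WQ.
Qed.

Lemma normal_orbit_corresponds X : is_normal X ->
  orbit_corresponds iota cQ (Sp_orbit X).
Proof.
move=> nX; split; first by exists X.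
move=> _ [g Sp_g ->]; have := conj_normal Sp_g nX; rewrite /conj_mx.
move: (_ *m invmx g) => X' [[Y [H YHX]] [W [gen WQ]]].
have spX' : sp X' by case: YHX => -[].
split.
  apply: rational_nil_orbit_of => //.
    by exists n.*2; exact: generators_nilpotent gen.
  exact: generators_jordan_type gen.
split; first by exists Y, H.
move=> Y' H' triple' j je jn; have [Qu iso] := cQQ je jn.
apply: (lowest_form_generators la_part natr_neq0 spX' gen _ triple' _ Qu iso).
  by case/andP: jn => /ltnW-> ->.
exact: WQ.
Qed.

End Orbit.

(** * Block frames *)
Section Frame.
Variables (k : fieldType) (h N m : nat).

(** An orthonormal decomposition of the coordinate space of dimension h into N
    blocks of size m.  Requiring F t = 0 beyond N lets shifted blocks F t.+1 be
    written without boundary cases. *)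
Definition frame (F : nat -> 'M[k]_(h, m)) : Prop :=
  [/\ forall s t, (s < N)%N -> (F s)^T *m F t = (s == t)%:R%:M,
      forall t, (N <= t)%N -> F t = 0
    & \sum_(t < N) F t *m (F t)^T = 1%:M].

Definition lowers (F : nat -> 'M[k]_(h, m)) (A : 'M[k]_h) : Prop :=
  A *m F 0%N = 0 /\ forall t, (t.+1 < N)%N -> A *m F t.+1 = F t.

(** The frame of a labelling of the coordinates: the coordinate a is the vector
    number [pos a] of the chain number [str a]. *)
Definition label_frame (pos str : 'I_h -> nat) t : 'M[k]_(h, m) :=
  \matrix_(a, b) ((pos a == t) && (str a == b :> nat))%:R.

Section LabelFrame.
Variables (pos str : 'I_h -> nat).
Hypotheses (hE : h = (N * m)%N) (posN : forall a, (pos a < N)%N)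
  (strm : forall a, (str a < m)%N)
  (inj : forall a b, pos a = pos b -> str a = str b -> a = b).

Let label_ex t b : (t < N)%N -> (b < m)%N -> exists a, pos a = t /\ str a = b.
Proof.
move=> tN bm; pose f a := (Ordinal (posN a), Ordinal (strm a)).
have f_inj : injective f by move=> a a' [? ?]; exact: inj.
have [|g _ fK] := inj_card_bij f_inj.
  by rewrite card_prod !card_ord hE.
by exists (g (Ordinal tN, Ordinal bm)); have [] := fK (Ordinal tN, Ordinal bm).
Qed.

Lemma label_frameP : frame (label_frame pos str).
Proof.
split=> [s t sN|t Nt|].
- apply/matrixP => b c; rewrite !mxE.
  have [a [<- ab]] := label_ex sN (ltn_ord b).
  rewrite (bigD1 a) //= !mxE ab !eqxx mul1r big1 ?addr0 => [|a' aa'].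
    by rewrite -val_eqE; case: eqP; case: eqP.
  rewrite !mxE; case: eqP => [pa|_]; last by rewrite mul0r.
  case: eqP => [sa|_]; last by rewrite mul0r.
  by case/eqP: aa'; apply: inj => //; rewrite sa ab.
- apply/matrixP => a b; rewrite !mxE; case: eqP => // E.
  by move: (posN a); rewrite E ltnNge Nt.
- apply/matrixP => a b; rewrite summxE (bigD1 (Ordinal (posN a))) //= mxE.
  rewrite (bigD1 (Ordinal (strm a))) //= !mxE !eqxx mul1r.
  rewrite [X in _ + _ + X]big1 => [|t /eqP ta]; last first.
    rewrite mxE big1 // => c _; rewrite mxE.
    by case: eqP => [E|]; rewrite ?mul0r //; case: ta; exact: val_inj.
  rewrite [X in _ + X + _]big1 ?addr0 => [|c /eqP ca]; last first.
    rewrite mxE; case: (str a =P c) => [E|_].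
      by case: ca; exact: val_inj.
    by rewrite andbF mul0r.
  congr (_%:R); case: (a =P b) => [->|ab]; first by rewrite !eqxx.
  by case: eqP => // pb; case: eqP => // sb; case: ab; exact: inj.
Qed.

Lemma label_lowers (A : 'M[k]_h) :
  (forall a b, A a b = ((str a == str b) && (pos b == (pos a).+1))%:R) ->
  lowers (label_frame pos str) A.
Proof.
move=> AE; split=> [|t tN]; apply/matrixP => a b; rewrite !mxE.
  rewrite big1 // => c _; rewrite AE mxE; case: (pos c) => [|p].
    by rewrite andbF mul0r.
  by rewrite mulr0.
have [c [ct cb]] := label_ex tN (ltn_ord b).
rewrite (bigD1 c) //= big1 ?addr0 => [|c' /eqP cc'].
  by rewrite AE mxE ct cb !eqxx mulr1 eqSS andbC eq_sym.
rewrite mxE; case: eqP => [pc|_]; last by rewrite mulr0.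
case: eqP => [sc|_]; last by rewrite mulr0.
by case: cc'; apply: inj; rewrite ?ct ?cb.
Qed.

End LabelFrame.

Variable F : nat -> 'M[k]_(h, m).
Hypothesis frameF : frame F.

Let orth s t : (s < N)%N -> (F s)^T *m F t = (s == t)%:R%:M.
Proof. by case: frameF => + _ _; exact. Qed.

Lemma frame_left0 r (l : 'M[k]_(r, h)) :
  (forall t, (t < N)%N -> l *m F t = 0) -> l = 0.
Proof.
case: frameF => _ _ one lF; rewrite -[l]mulmx1 -one mulmx_sumr big1 // => t _.
by rewrite mulmxA lF // mul0mx.
Qed.

Lemma frame_eq r (A B : 'M[k]_(r, h)) :
  (forall t, (t < N)%N -> A *m F t = B *m F t) -> A = B.
Proof.
move=> AB; apply/eqP; rewrite -subr_eq0; apply/eqP/frame_left0 => t tN.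
by rewrite mulmxBl AB // subrr.
Qed.

Definition frame_op (G : nat -> 'M[k]_(h, m)) : 'M[k]_h :=
  \sum_(t < N) G t *m (F t)^T.

Lemma frame_opE G t : (t < N)%N -> frame_op G *m F t = G t.
Proof.
move=> tN; rewrite mulmx_suml (bigD1 (Ordinal tN)) //= big1 => [|s].
  by rewrite addr0 -mulmxA orth // eqxx mulmx1.
by rewrite -val_eqE /= => /negbTE st; rewrite -mulmxA orth // st raddf0 mulmx0.
Qed.

(** The blocks being orthonormal, the transpose of a lowering shift is the
    raising shift. *)
Lemma lowers_tr A t : lowers F A -> (t < N)%N -> A^T *m F t = F t.+1.
Proof.
case=> A0 AS tN; have [_ out one] := frameF.
rewrite -[LHS]mul1mx -one mulmx_suml -[RHS]mul1mx -one mulmx_suml.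
apply: eq_bigr => s _; rewrite -!mulmxA; congr (_ *m _).
rewrite (orth _ (ltn_ord s)) mulmxA -trmx_mul.
case: s => -[|s] sN /=; first by rewrite A0 trmx0 mul0mx raddf0.
by rewrite AS // orth ?(ltnW sN) // eqSS.
Qed.

End Frame.

(** * Lie triples in block form *)
Section SpBlock.
Variables (k : fieldType) (h : nat).
Implicit Types A B C D : 'M[k]_h.

(** For symmetric B and C these are the elements of the symplectic Lie algebra
    in a symplectic basis. *)
Definition sp_block A B C : 'M[k]_(h + h) := block_mx A B C (- A^T).

Lemma sp_block_sp A B C : B^T = B -> C^T = C -> sp (sp_block A B C).
Proof.
move=> BT CT; rewrite /sp /sp_block /Jmx tr_block_mx !mulmx_block.
rewrite !mulmxN !mulNmx !mulmx0 !mul0mx !mulmx1 !mul1mx add_block_mx.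
rewrite !linearN /= trmxK BT CT !add0r !addr0 !opprK.
by rewrite subr0 !subrr addNr block_mx0.
Qed.

(** The remaining blocks of the three brackets are the transposes of those in
    the hypotheses. *)
Lemma sp_block_triple A B A' C' D :
  B^T = B -> C'^T = C' -> D^T = D ->
  D *m A - A *m D = A *+ 2 -> D *m A' - A' *m D = - (A' *+ 2) ->
  D *m B + B *m D = B *+ 2 -> D *m C' + C' *m D = C' *+ 2 ->
  A' *m B = 0 -> C' *m A = 0 ->
  A *m A' - A' *m A + B *m C' = D ->
  lie_triple (sp_block A' 0 C') (sp_block D 0 0) (sp_block A B 0).
Proof.
move=> BT CT DT DA DA' DB DC A'B CA AA'.
split; first by split; apply: sp_block_sp; rewrite ?trmx0.
have muln2 (M1 M2 M3 M4 : 'M[k]_h) :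
    block_mx M1 M2 M3 M4 *+ 2 = block_mx (M1 *+ 2) (M2 *+ 2) (M3 *+ 2) (M4 *+ 2).
  by rewrite !mulr2n add_block_mx.
have DAT : D *m A^T - A^T *m D = - (A^T *+ 2).
  by rewrite -{1}DT -{2}DT -!trmx_mul -linearB -opprB linearN DA linearMn.
have DAT' : D *m A'^T - A'^T *m D = A'^T *+ 2.
  rewrite -{1}DT -{2}DT -!trmx_mul -linearB -opprB linearN DA' /=.
  by rewrite linearN opprK linearMn.
have BA' : B *m A'^T = 0 by rewrite -BT -trmx_mul A'B trmx0.
have AC : A^T *m C' = 0 by rewrite -CT -trmx_mul CA trmx0.
rewrite /bracket /sp_block !mulmx_block !muln2 !opp_block_mx !add_block_mx DT.
rewrite !mulmxN !mulNmx !mulmx0 !mul0mx !addr0 !add0r !opprK !mul0rn.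
rewrite !oppr0 ?addr0 ?add0r.
split.
- by rewrite DA DB DAT mulNrn.
- by rewrite DA' DAT' -opprD DC mulNrn opprK.
- rewrite addrAC AA' BA' A'B AC CA !oppr0 addr0; congr block_mx.
  rewrite -DT -AA' [(_ + _)^T]linearD /= [(_ - _)^T]linearB /= !trmx_mul BT CT.
  by rewrite !opprD opprK (addrC (- (A'^T *m A^T))) addrA addrAC.
Qed.

End SpBlock.

(** Even j is the case where c is invertible, with N.+1 = j / 2; odd j is the
    case c = c' = 0, with N.+1 = j. *)
Section FrameTriple.
Variables (k : fieldType) (h N m j : nat) (F : nat -> 'M[k]_(h, m)).
Hypotheses (frameF : frame N.+1 F).
Variables (A : 'M[k]_h) (c c' : 'M[k]_m).
Hypotheses (lowA : lowers N.+1 F A) (cT : c^T = c) (c'T : c'^T = c').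
Hypothesis cc' : c *m c' = (N.+1%:R * (j%:R - N.+1%:R))%:M.
Hypotheses (jc : (j%:R - (2 * N.+1)%:R) *: c = 0).
Hypotheses (jc' : (j%:R - (2 * N.+1)%:R) *: c' = 0).

Definition corner (M : 'M[k]_m) : 'M[k]_h := F N *m M *m (F N)^T.

Let weight t : k := j%:R - 1 - (2 * t)%:R.
Let raise t : k := t.+1%:R * (j%:R - t.+1%:R).
Let D := frame_op N.+1 F (fun t => weight t *: F t).
Let A' := frame_op N.+1 F (fun t => raise t *: F t.+1).

Let D_F t : (t < N.+1)%N -> D *m F t = weight t *: F t.
Proof. exact: frame_opE. Qed.

Let A'_F t : (t < N.+1)%N -> A' *m F t = raise t *: F t.+1.
Proof. exact: frame_opE. Qed.

Lemma corner_F M t : (t < N.+1)%N -> corner M *m F t = (t == N)%:R *: (F N *m M).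
Proof.
case: frameF => orth _ _ tN; rewrite /corner -mulmxA orth // eq_sym.
by case: eqP; rewrite ?raddf0 ?mulmx0 ?scale0r // mulmx1 scale1r.
Qed.

Lemma corner_tr M : M^T = M -> (corner M)^T = corner M.
Proof. by move=> MT; rewrite /corner !trmx_mul trmxK MT mulmxA. Qed.

Let F_out : F N.+1 = 0. Proof. by case: frameF => _ + _; apply. Qed.

Let D_tr : D^T = D.
Proof.
rewrite /D /frame_op linear_sum; apply: eq_bigr => t _ /=.
by rewrite trmx_mul trmxK linearZ /= -scalemxAl -scalemxAr.
Qed.

Let D_corner M : (j%:R - (2 * N.+1)%:R) *: M = 0 ->
  D *m corner M + corner M *m D = corner M *+ 2.
Proof.
move=> jM.
have DC : D *m corner M = weight N *: corner M.
  by rewrite /corner !mulmxA D_F // -!scalemxAl.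
have CD : corner M *m D = weight N *: corner M.
  rewrite /corner -mulmxA -{1}D_tr -trmx_mul D_F //.
  by rewrite [(_ *: _)^T]linearZ /= -scalemxAr.
rewrite DC CD -mulr2n; congr (_ *+ 2); apply/eqP; rewrite -subr_eq0.
rewrite -{2}[corner M]scale1r -scalerBl.
rewrite (_ : _ - 1 = j%:R - (2 * N.+1)%:R); last by rewrite /weight; ring.
by rewrite /corner scalemxAl scalemxAr jM mulmx0 mul0mx.
Qed.

(** On the blocks F_t the required relations are those of the irreducible
    module of dimension j.  In the last block the raising coefficient
    (N+1)(j-N-1) must be supplied by c c', because Y passes there from the
    p-part to the q-part, or vanish with it when the chain stops there. *)
Lemma frame_lie_triple :
  exists Y H, lie_triple Y H (sp_block A (corner c) 0).
Proof.
case: (lowA) => A0 AS.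
exists (sp_block A' 0 (corner c')), (sp_block D 0 0).
apply: sp_block_triple; try exact: corner_tr.
- exact: D_tr.
- apply: (frame_eq frameF) => -[|t] tN.
    rewrite mulmxBl mulmxDl -!mulmxA D_F // -scalemxAr A0 mulmx0.
    by rewrite scaler0 subr0 addr0.
  rewrite mulmxBl mulmxDl -!mulmxA D_F // -scalemxAr AS // D_F ?(ltnW tN) //.
  rewrite -scalerBl -[F t + _]mulr2n -scaler_nat; congr (_ *: _); rewrite /weight.
  by ring.
- apply: (frame_eq frameF) => t tN.
  rewrite mulmxBl mulNmx mulmxDl -!mulmxA D_F // A'_F // -!scalemxAr A'_F //.
  have [tN'|] := ltnP t.+1 N.+1; last first.
    move=> Nt; rewrite (_ : t = N); last by apply/eqP; rewrite eqn_leq -ltnS tN.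
    by rewrite F_out mulmx0 !scaler0 subrr addr0 oppr0.
  rewrite D_F // !scalerA -scalerBl -scalerDl -scaleNr; congr (_ *: _).
  by rewrite /weight; ring.
- exact: D_corner.
- exact: D_corner.
- apply: (frame_eq frameF) => t tN; rewrite mul0mx -mulmxA corner_F //.
  by rewrite -scalemxAr mulmxA A'_F // F_out scaler0 mul0mx scaler0.
- apply: (frame_eq frameF) => -[|t] tN; rewrite mul0mx -mulmxA.
    by rewrite A0 mulmx0.
  rewrite AS // corner_F ?(ltnW tN) //.
  by rewrite ltn_eqF ?scale0r.
- apply: (frame_eq frameF) => t tN.
  rewrite mulmxDl mulmxBl -(mulmxA A) -(mulmxA A') -(mulmxA (corner c)).
  rewrite D_F // A'_F // corner_F //.
  rewrite -!scalemxAr (mulmxA (corner c)) corner_F // eqxx scale1r.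
  have AA'F : A *m F t.+1 = (t != N)%:R *: F t.
    have [->|tN'] := eqVneq t N; first by rewrite F_out mulmx0 scale0r.
    by rewrite AS ?scale1r // ltnS ltn_neqAle tN'.
  have A'AF : A' *m (A *m F t) = (t%:R * (j%:R - t%:R)) *: F t.
    case: (t) tN => [|s] sN; first by rewrite A0 mulmx0 mul0r scale0r.
    by rewrite AS // A'_F // ltnW.
  rewrite AA'F A'AF -mulmxA cc' mul_mx_scalar !scalerA.
  have [->|tN'] := eqVneq t N.
    rewrite /= mul1r mulr0 scale0r sub0r -scaleNr -scalerDl; congr (_ *: _).
    by rewrite /weight; ring.
  rewrite /= mul0r scale0r addr0 mulr1 -scalerBl; congr (_ *: _).
  by rewrite /weight /raise; ring.
Qed.

End FrameTriple.

(** * Generators in block form *)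
Section FrameGenerators.
Variables (k : fieldType) (h N m : nat) (F : nat -> 'M[k]_(h, m)).
Hypotheses (frameF : frame N.+1 F).
Variables (A : 'M[k]_h) (c : 'M[k]_m).
Hypotheses (lowA : lowers N.+1 F A).
Local Notation X := (sp_block A (corner N F c) 0).

Let X_col r (u v : 'M[k]_(h, r)) :
  X *m col_mx u v = col_mx (A *m u + corner N F c *m v) (- (A^T *m v)).
Proof. by rewrite /sp_block mul_block_col mul0mx add0r mulNmx. Qed.

Let upper s t r (M : 'M[k]_(m, r)) : (t <= s)%N -> (s <= N)%N ->
  X ^+ t *m col_mx (F s *m M) 0 = col_mx (F (s - t)%N *m M) 0.
Proof.
case: (lowA) => _ AS; elim: t => [|t IHt] ts sN; first by rewrite exp0mx subn0.
rewrite expSmx IHt ?(ltnW ts) // X_col !mulmx0 addr0 oppr0 mulmxA.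
by rewrite (_ : s - t = (s - t.+1).+1)%N ?AS //; lia.
Qed.

Let upper_end s r (M : 'M[k]_(m, r)) : (s <= N)%N ->
  X ^+ s.+1 *m col_mx (F s *m M) 0 = 0.
Proof.
case: (lowA) => A0 _ sN; rewrite expSmx upper // subnn X_col mulmxA A0.
by rewrite mul0mx !mulmx0 addr0 oppr0 col_mx0.
Qed.

Let lower t : (t <= N)%N ->
  X ^+ t *m col_mx 0 (F 0) = (-1) ^+ t *: col_mx 0 (F t).
Proof.
elim: t => [|t IHt] tN; first by rewrite exp0mx scale1r.
rewrite expSmx IHt ?(ltnW tN) // -scalemxAr X_col mulmx0 add0r.
rewrite corner_F ?ltn_eqF // ?scale0r 1?ltnW // (lowers_tr frameF lowA) 1?ltnW //.
by rewrite exprS mulN1r scaleNr -scalerN opp_col_mx oppr0.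
Qed.

Let lower_end :
  X ^+ N.+1 *m col_mx 0 (F 0) = (-1) ^+ N *: col_mx (F N *m c) 0.
Proof.
have [_ out _] := frameF.
rewrite expSmx lower // -scalemxAr X_col mulmx0 add0r corner_F // eqxx scale1r.
by rewrite (lowers_tr frameF lowA) // (out N.+1) // oppr0.
Qed.

Let lower_upper t : (t <= N)%N -> X ^+ (t + N.+1) *m col_mx 0 (F 0)
  = (-1) ^+ N *: col_mx (F (N - t)%N *m c) 0.
Proof. by move=> tN; rewrite expDmx lower_end -scalemxAr upper. Qed.

Let kill_scaled r s (l : 'M[k]_(r, h + h)) (u v : 'M[k]_(h + h, s)) t :
  v = (-1) ^+ t *: u -> l *m v = 0 -> l *m u = 0.
Proof.
by move=> -> /eqP; rewrite -scalemxAr scaler_eq0 signr_eq0 => /eqP.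
Qed.

(** The powers of X move the first q-block through all the q-blocks, with
    alternating signs, then through c into the last p-block, and from there down
    to the first p-block. *)
Lemma even_generators : c \in unitmx ->
  [/\ X ^+ N.+1.*2 *m col_mx 0 (F 0) = 0,
      forall r (l : 'M[k]_(r, h + h)),
        (forall t, l *m (X ^+ t *m col_mx 0 (F 0)) = 0) -> l = 0
    & (col_mx 0 (F 0))^T *m Jmx k h *m (X ^+ N.+1.*2.-1 *m col_mx 0 (F 0))
      = (-1) ^+ N.+1 *: c].
Proof.
move=> cu; split.
- rewrite -addnn expDmx lower_end -scalemxAr upper_end //.
  exact: scaler0.
- move=> r l lX; rewrite -[l]hsubmxK; move: lX; rewrite -{1}[l]hsubmxK.
  move: (lsubmx l) (rsubmx l) => l1 l2 lX.
  rewrite (_ : l1 = 0) 1?(_ : l2 = 0) ?row_mx0 //.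
    apply: (frame_left0 frameF) => t tN.
    have := kill_scaled (lower tN) (lX t).
    by rewrite mul_row_col mulmx0 add0r.
  apply: (frame_left0 frameF) => t tN.
  have tN' : (N - t <= N)%N by lia.
  have := kill_scaled (lower_upper tN') (lX _).
  rewrite mul_row_col mulmx0 addr0 subKn // mulmxA.
  by move/(congr1 (mulmx^~ (invmx c))); rewrite mulmxK // mul0mx.
- have -> : (N.+1.*2.-1 = N + N.+1)%N by lia.
  have [orth _ _] := frameF.
  rewrite lower_upper // subnn -scalemxAr -mulmxA /Jmx mul_block_col.
  rewrite !mul0mx mulNmx !mul1mx !addr0 tr_col_mx mul_row_col.
  rewrite trmx0 mul0mx add0r mulmxN mulmxA orth // mul1mx.
  by rewrite exprS mulN1r scaleNr scalerN.
Qed.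

Lemma odd_generators : c = 0 ->
  let W := row_mx (col_mx (F N) 0) (col_mx 0 (F 0)) in
  X ^+ N.+1 *m W = 0 /\
  forall r (l : 'M[k]_(r, h + h)), (forall t, l *m (X ^+ t *m W) = 0) -> l = 0.
Proof.
move=> c0 W; have upN t : (t <= N)%N ->
    X ^+ t *m col_mx (F N) 0 = col_mx (F (N - t)%N) 0.
  by move=> tN; have := upper 1%:M tN (leqnn N); rewrite !mulmx1.
split.
  rewrite mul_mx_row lower_end {2}c0 mulmx0 col_mx0 scaler0.
  by rewrite -[F N]mulmx1 upper_end // row_mx0.
move=> r l lX; have {}lX t : l *m (X ^+ t *m col_mx (F N) 0) = 0 /\
                          l *m (X ^+ t *m col_mx 0 (F 0)) = 0.
  by have := lX t; rewrite !mul_mx_row -[RHS]row_mx0 => /eq_row_mx.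
rewrite -[l]hsubmxK; move: lX; rewrite -{1 2}[l]hsubmxK.
move: (lsubmx l) (rsubmx l) => l1 l2 lX.
rewrite (_ : l1 = 0) 1?(_ : l2 = 0) ?row_mx0 //.
  apply: (frame_left0 frameF) => t tN; have [_ lXt] := lX t.
  by have := kill_scaled (lower tN) lXt; rewrite mul_row_col mulmx0 add0r.
apply: (frame_left0 frameF) => t tN; have [+ _] := lX (N - t)%N.
by rewrite upN ?leq_subr // mul_row_col mulmx0 addr0 subKn.
Qed.

End FrameGenerators.

(** * Frames of the blocks of the normal form *)

(** In J_N tensor I_m the coordinate a is the entry number a %% m of the block
    number a %/ m. *)
Lemma even_label_frame (k : fieldType) (h m N : nat) (M : 'M[k]_m) :
  (m * N + m)%N = h ->
  exists F : nat -> 'M[k]_(h, m),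
    [/\ frame N.+1 F, lowers N.+1 F (jordan_block k h ^+ m)
      & conform_mx (0 : 'M[k]_h) (block_mx (0 : 'M[k]_(m * N)) 0 0 M)
        = corner N F M].
Proof.
move=> hE; have m_gt0 (a : 'I_h) : (0 < m)%N.
  rewrite lt0n; apply/eqP => m0; have h0 : h = 0%N by rewrite -hE m0.
  by have := ltn_ord a; rewrite [X in (_ < X)%N]h0.
pose pos (a : 'I_h) := (a %/ m)%N; pose str (a : 'I_h) := (a %% m)%N.
have hE' : h = (N.+1 * m)%N by rewrite -hE mulSn addnC mulnC.
have posN a : (pos a < N.+1)%N by rewrite /pos ltn_divLR ?(m_gt0 a) // -hE'.
have strm a : (str a < m)%N by rewrite ltn_pmod ?(m_gt0 a).
have inj a b : pos a = pos b -> str a = str b -> a = b.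
  move=> p s; apply: val_inj => /=.
  by rewrite (divn_eq a m) (divn_eq b m) -/(pos a) -/(str a) p s.
exists (label_frame k m pos str); split.
- exact: label_frameP.
- apply: label_lowers => // a b; rewrite jordan_block_exp.
  congr (nat_of_bool _)%:R.
  apply/eqP/andP => [E|[/eqP s /eqP p]].
    by rewrite /str /pos E modnDr eqxx divnDr // divnn (m_gt0 a) addn1.
  rewrite (divn_eq a m) (divn_eq b m) -/(pos a) -/(str a) -/(pos b) -/(str b).
  rewrite s p mulSn; lia.
- rewrite /corner /pos /str; clear -hE; case: h / hE.
  have m_gt0 (a : 'I_m) : (0 < m)%N by apply: leq_ltn_trans (ltn_ord a).
  rewrite conform_mx_id (_ : label_frame _ _ _ _ _ = col_mx 0 1%:M).
    rewrite mul_col_mx mul0mx mul1mx tr_col_mx mul_col_row trmx0 trmx1.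
    by rewrite !mulmx0 !mulmx1.
  apply/matrixP => a b; rewrite [LHS]mxE [RHS]mxE; case: splitP => i ->.
    rewrite mxE (_ : (i %/ m)%N == N = false) //; apply: ltn_eqF.
    by rewrite ltn_divLR ?(m_gt0 b) // (leq_trans (ltn_ord i)) // mulnC.
  rewrite mxE mulnC divnMDl ?(m_gt0 b) // divn_small // addn0 eqxx /=.
  by rewrite modnMDl modn_small // -val_eqE.
Qed.

Lemma conform_jordan_block (R : pzRingType) (p p' : nat) (a : 'I_p) (b : 'I_p') :
  p = p' -> conform_mx 0 (jordan_block R p) a b = (b == a.+1 :> nat)%:R.
Proof. by move=> e; case: p' / e b => b; rewrite conform_mx_id mxE. Qed.

Lemma odd_label_frame (k : fieldType) (h m j : nat) : 
  (\sum_(i < size (nseq m j)) nth 0 (nseq m j) i)%N = h ->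
  exists F : nat -> 'M[k]_(h, m),
    frame j F /\
    lowers j F (conform_mx (0 : 'M[k]_h) (jordan_mx k (nseq m j))).
Proof.
move=> hE; case: h / hE; rewrite conform_mx_id.
have hE : (\sum_(i < size (nseq m j)) nth 0 (nseq m j) i = j * m)%N.
  rewrite -(big_mkord xpredT (nth 0%N _)) -(big_nth 0%N xpredT id) big_nseq.
  by rewrite iter_addn_0.
pose str (a : 'I_(\sum_(i < size (nseq m j)) nth 0 (nseq m j) i)) :=
  tagnat.sig1 a : nat.
pose pos (a : 'I_(\sum_(i < size (nseq m j)) nth 0 (nseq m j) i)) :=
  tagnat.sig2 a : nat.
have posj a : (pos a < j)%N.
  apply: leq_trans (ltn_ord (tagnat.sig2 a)) _.
  by rewrite nth_nseq; case: ifP.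
have strm a : (str a < m)%N.
  by rewrite -[X in (_ < X)%N](size_nseq m j) ltn_ord.
have inj a b : pos a = pos b -> str a = str b -> a = b.
  move=> p s; apply: val_inj => /=; rewrite [LHS]tagnat.rect [RHS]tagnat.rect.
  by rewrite -/(pos a) -/(pos b) -/(str a) -/(str b) p s.
exists (label_frame k m pos str); split; first exact: label_frameP.
apply: label_lowers => // a b.
rewrite mxE -val_eqE -/(str a) -/(str b); case: eqP => [/val_inj E|_]; last first.
  by rewrite mxE.
by rewrite conform_jordan_block // /str E.
Qed.

Section BlockModel.
Variables (k : fieldType) (la : seq nat) (Q : forall j : nat, 'M[k]_(mult la j)).
Hypothesis la_odd : forall j, odd j -> ~~ odd (mult la j).
Variable j : nat.
Hypothesis j_gt0 : (0 < j)%N.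
Local Notation h := (half_dim la j).
Local Notation X := (Xblock Q j).

Let Xblock_even : ~~ odd j -> exists N (F : nat -> 'M[k]_(h, mult la j)) A,
  [/\ j = N.+1.*2, frame N.+1 F, lowers N.+1 F A
    & X = sp_block A (corner N F ((-1) ^+ N.+1 *: Q j)) 0].
Proof.
move=> je; have jE : j = (j./2).-1.+1.*2 by move: je; lia.
exists (j./2).-1.
have [F [frF lowF CE]] := even_label_frame ((-1) ^+ (j./2).-1.+1 *: Q j)
                            (even_block_size la je j_gt0).
exists F, (jordan_block k h ^+ mult la j); split=> //.
rewrite -CE /Xblock (negbTE je) /even_block /sp_block.
by rewrite [in (-1) ^+ j./2](_ : j./2 = (j./2).-1.+1) //; lia.
Qed.

Let Xblock_odd : odd j -> exists N (F : nat -> 'M[k]_(h, (mult la j)./2)) A,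
  [/\ j = N.+1, frame N.+1 F, lowers N.+1 F A
    & X = sp_block A (corner N F 0) 0].
Proof.
move=> jo; exists j.-1; rewrite prednK //.
have [F [frF lowF]] := odd_label_frame k (odd_block_size la_odd jo).
exists F, (conform_mx 0 (jordan_mx k (nseq (mult la j)./2 j))); split=> //.
by rewrite /Xblock jo /odd_block /sp_block /corner mulmx0 mul0mx.
Qed.

Lemma Xblock_lie_triple : (~~ odd j -> nondeg_form (Q j)) ->
  exists Y H, lie_triple Y H X.
Proof.
case: (boolP (odd j)) => [/Xblock_odd|/Xblock_even];
  move=> [N [F [A [jE frF lowA ->]]]] Qj.
  apply: (@frame_lie_triple _ _ _ _ j _ frF _ 0 0 lowA);
    rewrite ?trmx0 ?scaler0 //.
  by rewrite mul0mx jE subrr mulr0 raddf0.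
have [QT Qu] := Qj isT.
have jR : j%:R = (2 * N.+1)%:R :> k by rewrite [in LHS]jE -muln2 mulnC.
(* c' is the inverse of (-1)^(N+1) Q_j times the raising coefficient (N+1)^2
   of the last block. *)
pose c' := ((-1) ^+ N.+1 * N.+1%:R ^+ 2) *: invmx (Q j).
apply: (@frame_lie_triple _ _ _ _ j _ frF _ _ c' lowA).
- by rewrite linearZ /= QT.
- by rewrite linearZ /= trmx_inv QT.
- rewrite -scalemxAl -scalemxAr mulmxV // scalerA mulrA -exprMn mulrNN mulr1.
  rewrite expr1n mul1r scalemx1; congr (_%:M).
  by rewrite jR; ring.
- by rewrite jR subrr scale0r.
- by rewrite jR subrr scale0r.
Qed.

Lemma Xblock_generators : (~~ odd j -> nondeg_form (Q j)) ->
  exists W : 'M[k]_(h + h, mult la j),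
  [/\ X ^+ j *m W = 0,
      forall r (l : 'M[k]_(r, h + h)), (forall t, l *m (X ^+ t *m W) = 0) -> l = 0
    & ~~ odd j -> W^T *m Jmx k h *m (X ^+ j.-1 *m W) = Q j].
Proof.
case: (boolP (odd j)) => jo Qj.
  have [N [F [A [jE frF lowA XE]]]] := Xblock_odd jo.
  have [XW span] := odd_generators frF lowA (erefl 0).
  have mE : ((mult la j)./2 + (mult la j)./2)%N = mult la j.
    by rewrite addnn -[RHS]odd_double_half (negbTE (la_odd jo)).
  suff [W [WX Wspan]] : exists W : 'M[k]_(h + h, mult la j), X ^+ j *m W = 0 /\
      forall r (l : 'M[k]_(r, h + h)), (forall t, l *m (X ^+ t *m W) = 0) -> l = 0.
    by exists W.
  move: XW span; rewrite -XE -jE; move: (row_mx _ _); rewrite mE => W XW span.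
  by exists W.
have [N [F [A [jE frF lowA XE]]]] := Xblock_even jo.
have [_ Qu] := Qj isT.
have cu : (-1) ^+ N.+1 *: Q j \in unitmx.
  by rewrite unitmxZ // unitrX // unitrN1.
have [] := even_generators frF lowA cu.
rewrite -jE -XE => XW span form; exists (col_mx 0 (F 0)); split=> // _.
by rewrite form scalerA -exprMn mulrNN mulr1 expr1n scale1r.
Qed.

End BlockModel.

(** * The direct sum of the blocks *)
Lemma finite_choice (T : nat -> Type) (P : forall j, T j -> Prop)
    (x0 : forall j, T j) m :
  (forall j, (0 < j <= m)%N -> exists x, P j x) ->
  exists f : forall j, T j, forall j, (0 < j <= m)%N -> P j (f j).
Proof.
elim: m => [|m IHm] ex; first by exists x0 => j; lia.
have [|f fP] := IHm; first by move=> j jm; apply: ex; lia.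
have [|x xP] := ex m.+1; first by lia.
exists (dfwith f x) => j jm; have [->|jm'] := eqVneq j m.+1.
  by rewrite dfwith_in.
by rewrite dfwith_out 1?eq_sym //; apply: fP; lia.
Qed.

Section Embedding.
Variables (k : fieldType) (n : nat) (la : seq nat).
Hypothesis la_part : is_partition n.*2 la.
Hypothesis la_odd : forall j, odd j -> ~~ odd (mult la j).
Local Notation h := (half_dim la).
Local Notation incl := (incl k n la).
Local Notation family := (forall j, 'M[k]_(h j + h j)).
Implicit Types M : family.

(** The subspaces V(j) span V, because the intervals of length [half_dim j]
    starting at [shift j] cover all the indices below n. *)
Lemma incl_left0 r (l : 'M[k]_(r, n + n)) :
  (forall j, (0 < j <= n.*2)%N -> l *m incl j = 0) -> l = 0.
Proof.
have locate m u : (u < shift la m.+1)%N ->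
    exists2 j, (0 < j <= m)%N & (shift la j <= u < shift la j + h j)%N.
  elim: m => [|m IHm] um; first by move: um; rewrite /shift big_geq.
  have [/IHm [j jm ju]|mu] := ltnP u (shift la m.+1).
    by exists j => //; lia.
  by exists m.+1; rewrite ?leqnn // mu -shiftS.
move=> lE; rewrite -[l]hsubmxK.
have half0 (l' : 'M[k]_(r, n)) : (forall j, (0 < j <= n.*2)%N -> l' *m
      \matrix_(i < n, a < h j) (i == (shift la j + a)%N :> nat)%:R = 0) -> l' = 0.
  move=> l'E; apply/matrixP => i u; rewrite mxE.
  have [|j jn /andP[ju uj]] := locate n.*2 u.
    by rewrite (shift_total la_part la_odd).
  have lt_a : (u - shift la j < h j)%N by lia.
  have /matrixP/(_ i (Ordinal lt_a)) := l'E j jn; rewrite !mxE => <-.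
  have uE : (shift la j + Ordinal lt_a)%N = u by exact: subnKC.
  rewrite (bigD1 u) //= mxE uE eqxx mulr1 big1 ?addr0 // => v vu.
  by rewrite mxE uE val_eqE (negbTE vu) mulr0.
rewrite [lsubmx l]half0 1?[rsubmx l]half0 ?row_mx0 // => j jn;
  have := lE j jn; rewrite -{1}[l]hsubmxK /Defs.incl mul_row_block !mulmx0;
  by rewrite addr0 add0r -row_mx0 => /eq_row_mx [].
Qed.

Lemma incl_eq (A B : 'M[k]_(n + n)) :
  (forall j, (0 < j <= n.*2)%N -> A *m incl j = B *m incl j) -> A = B.
Proof.
move=> AB; apply/eqP; rewrite -subr_eq0; apply/eqP/incl_left0 => j jn.
by rewrite mulmxBl AB // subrr.
Qed.

Lemma Jmx_incl j : Jmx k n *m incl j = incl j *m Jmx k (h j).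
Proof.
rewrite /Jmx /Defs.incl !mulmx_block !mul0mx !mulmx0 !mul1mx !mulmx1.
by rewrite !mulNmx !mulmxN !mul1mx !mulmx1 !addr0 !add0r.
Qed.

Definition emb M : 'M[k]_(n + n) :=
  \sum_(1 <= j < n.*2.+1 | mult la j != 0%N) incl j *m M j *m (incl j)^T.

Lemma emb_incl M j : (0 < j <= n.*2)%N -> emb M *m incl j = incl j *m M j.
Proof.
move=> jn; have /andP[j0 jn'] := jn; have [mj|mj] := eqVneq (mult la j) 0%N.
  have h0 : h j = 0%N by rewrite /half_dim mj muln0.
  apply/matrixP => a b; have := ltn_ord b.
  by rewrite [X in (_ < X)%N](_ : _ = 0%N) // h0.
rewrite mulmx_suml big_mkcond (bigD1_seq j) ?iota_uniq ?mem_index_iota ?j0 //= mj.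
rewrite big1_seq => [|i /andP[ij]]; last first.
  rewrite mem_index_iota => /andP[i0 _]; case: ifP => // _.
  by rewrite -!mulmxA incl_mul_neq // !mulmx0.
by rewrite addr0 -!mulmxA incl_mul_id // mulmx1.
Qed.

Lemma emb_tr M : (emb M)^T = emb (fun j => (M j)^T).
Proof.
rewrite /emb linear_sum; apply: eq_bigr => j _ /=.
by rewrite !trmx_mul trmxK mulmxA.
Qed.

Lemma emb_exp M j t r (w : 'M[k]_(h j + h j, r)) : (0 < j <= n.*2)%N ->
  emb M ^+ t *m (incl j *m w) = incl j *m (M j ^+ t *m w).
Proof.
move=> jn; elim: t => [|t IHt]; first by rewrite !exp0mx.
by rewrite !expSmx IHt (mulmxA (emb M)) emb_incl // -mulmxA.
Qed.

Lemma emb_sp M : (forall j, (0 < j <= n.*2)%N -> sp (M j)) -> sp (emb M).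
Proof.
move=> spM; apply: incl_eq => j jn.
rewrite mulmxDl -!mulmxA Jmx_incl emb_tr (mulmxA (emb _)) !emb_incl //.
by rewrite (mulmxA (Jmx k n)) Jmx_incl -!mulmxA -mulmxDr spM // mulmx0 mul0mx.
Qed.

Lemma emb_bracket M M' j : (0 < j <= n.*2)%N ->
  bracket (emb M) (emb M') *m incl j = incl j *m bracket (M j) (M' j).
Proof.
move=> jn; rewrite /bracket mulmxBl -!mulmxA !emb_incl // !mulmxA !emb_incl //.
by rewrite mulmxBr !mulmxA.
Qed.

Lemma emb_lie_triple (Y H X : family) :
  (forall j, (0 < j <= n.*2)%N -> lie_triple (Y j) (H j) (X j)) ->
  lie_triple (emb Y) (emb H) (emb X).
Proof.
move=> triple; split.
  by split; apply: emb_sp => j /triple [[]].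
split; apply: incl_eq => j jn; have [_ [HX HY XY]] := triple j jn;
  rewrite emb_bracket // ?HX ?HY ?XY ?mulNmx ?mulmxN ?mulr2n ?mulmxDl ?emb_incl //;
  by rewrite mulmxDr.
Qed.

Variable Q : forall j : nat, 'M[k]_(mult la j).
Hypothesis Q_nondeg :
  forall j, ~~ odd j -> (2 <= j <= n.*2)%N -> nondeg_form (Q j).

Let nondegQ j : (0 < j <= n.*2)%N -> ~~ odd j -> nondeg_form (Q j).
Proof. by move=> jn je; apply: Q_nondeg => //; lia. Qed.

Lemma emb_Xblock_normal : is_normal Q (emb (fun j => Xblock Q j)).
Proof.
split.
  have [|YH YHP] := @finite_choice
    (fun j => ('M[k]_(h j + h j) * 'M[k]_(h j + h j))%type)
    (fun j YH => lie_triple YH.1 YH.2 (Xblock Q j)) (fun=> (0, 0)) n.*2.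
    move=> j jn; have /andP[j0 _] := jn.
    by have [Y [H YHX]] := Xblock_lie_triple la_odd j0 (nondegQ jn); exists (Y, H).
  exists (emb (fun j => (YH j).1)), (emb (fun j => (YH j).2)).
  exact: emb_lie_triple.
have [W WP] := @finite_choice _ _ (fun j => 0 : 'M[k]_(h j + h j, mult la j)) n.*2
  (fun j jn => Xblock_generators la_odd (proj1 (andP jn)) (nondegQ jn)).
exists (fun j => incl j *m W j); split.
  split=> [j jn|r l lW].
    by have [XW _ _] := WP j jn; rewrite emb_exp // XW mulmx0.
  apply: incl_left0 => j jn; have [_ span _] := WP j jn; apply: span => t.
  by rewrite -mulmxA -emb_exp // lW.
move=> j je jn; have jn' : (0 < j <= n.*2)%N by lia.
have [_ _ form] := WP j jn'; rewrite -[RHS]form // emb_exp // trmx_mul.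
rewrite -!mulmxA (mulmxA (Jmx k n)) Jmx_incl !mulmxA.
by rewrite -(mulmxA _ _ (incl j)) incl_mul_id // mulmx1.
Qed.

Lemma basis_mx_Sp (p q : 'I_n -> 'cV[k]_(n + n)) :
  symplectic_basis p q -> Sp (basis_mx p q).
Proof.
move=> [hpq hqp hpp hqq].
have gram (f g : 'I_n -> 'cV[k]_(n + n)) :
    (\matrix_(u, i) f i u 0)^T *m Jmx k n *m (\matrix_(u, i) g i u 0)
    = \matrix_(i, j) sform (f i) (g j).
  apply/matrixP => i j; rewrite -form_entry mxE.
  by congr sform; apply/colP => u; rewrite !mxE.
rewrite /Sp /basis_mx tr_row_mx mul_col_mx mul_col_row !gram /Jmx.
congr block_mx; apply/matrixP => i j; rewrite !mxE ?hpp ?hqq ?hpq ?hqp //.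
by rewrite eq_sym.
Qed.

Lemma normal_form_normal (p q : 'I_n -> 'cV[k]_(n + n)) :
  symplectic_basis p q -> is_normal Q (normal_form Q p q).
Proof.
by move=> /basis_mx_Sp Sp_pq; exact: (conj_normal Sp_pq emb_Xblock_normal).
Qed.

End Embedding.

(** * The theorem *)
Lemma small_natr_neq0 (k : fieldType) (p m : nat) :
  [pchar k] =i pred0 \/ (p \in [pchar k] /\ (m < p)%N) ->
  forall i, (0 < i <= m)%N -> i%:R != 0 :> k.
Proof.
case=> [/GRing.pcharf0P k0|[kp mp]] i im; first by rewrite k0; lia.
rewrite -(GRing.dvdn_pcharf kp); apply/negP => /dvdn_leq.
by lia.
Qed.

Lemma isometric_nondeg (k : fieldType) m (q q' : 'M[k]_m) :
  isometric q q' -> nondeg_form q -> nondeg_form q'.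
Proof.
move=> [g gu <-] [qT qu]; split; last by rewrite !unitmx_mul unitmx_tr gu qu.
by rewrite !trmx_mul trmxK qT mulmxA.
Qed.

Lemma isometric_dim0 (k : fieldType) m (q q' : 'M[k]_m) :
  m = 0%N -> isometric q q'.
Proof.
move=> m0; exists 1%:M; first exact: unitmx1.
by apply/matrixP => a; have := ltn_ord a; rewrite [X in (_ < X)%N]m0.
Qed.
Unset Implicit Arguments.

Theorem proposition5p5
  (k : fieldType) (val : k -> int) (hk : is_local_field val)
  (w : k) (hw : is_uniformizer val w)
  (K : closedFieldType) (iota : {rmorphism k -> K})
  (hK : forall z : K, algebraicOver iota z)
  (n : nat) (hn : (2 <= n)%N)
  (pres : nat) (hpres : residue_char val pres) (hodd : odd pres)
  (hchar : [pchar k] =i pred0 \/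
           (pres \in [pchar k] /\ (3 * (2 * n - 1) < pres)%N))
  (eps : k) (heps0 : eps != 0) (heps : val eps = 0)
  (heps_nsq : ~ is_square eps)
  (alpha : k)
  (halpha1 : is_square (-1 : k) -> alpha = eps)
  (halpha2 : ~ is_square (-1 : k) -> eps = -1 /\ alpha = 1)
  (p q : 'I_n -> 'cV[k]_(n + n)) (hpq : symplectic_basis p q)
  (la : seq nat) (hla : is_partition n.*2 la)
  (hla_odd : forall j : nat, odd j -> ~~ odd (mult la j))
  (cQ : forall j : nat, 'M[k]_(mult la j))
  (hcQ : forall j : nat, ~~ odd j -> (2 <= j <= n.*2)%N -> nondeg_form (cQ j))
  (Q : forall j : nat, 'M[k]_(mult la j))
  (hQ : forall j : nat, ~~ odd j -> (2 <= j <= n.*2)%N -> mult la j != 0%N ->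
          minimal_representative eps alpha w (cQ j) (Q j)) :
  let X : 'M[k]_(n + n) := normal_form Q p q in
  sp X /\
  exists O : 'M[k]_(n + n) -> Prop, orbit_corresponds iota cQ O /\ O X.
Proof.
move=> X.
have isoQ j : ~~ odd j -> (2 <= j <= n.*2)%N -> isometric (cQ j) (Q j).
  move=> je jn; have [m0|m0] := eqVneq (mult la j) 0%N.
    exact: isometric_dim0.
  by have [] := hQ j je jn m0.
have nondegQ j : ~~ odd j -> (2 <= j <= n.*2)%N -> nondeg_form (Q j).
  by move=> je jn; apply: isometric_nondeg (isoQ j je jn) (hcQ j je jn).
have natr_neq0 : forall i, (0 < i <= 2 * n.*2)%N -> i%:R != 0 :> k.
  apply: (@small_natr_neq0 k pres); case: hchar => [|[kp lp]]; first by left.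
  by right; split=> //; lia.
have normalX : is_normal Q X by exact: normal_form_normal.
have spX : sp X by case: normalX => -[Y [H [[_ _ ?] _]]] _.
split=> //; exists (Sp_orbit X); split.
  apply: (normal_orbit_corresponds iota hla natr_neq0 _ normalX) => j je jn.
  by split; [case: (nondegQ j je jn) | exact: isoQ].
exists 1%:M; first by rewrite /Sp trmx1 mul1mx mulmx1.
by rewrite invmx1 mulmx1 mul1mx.
Qed.
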